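(* Assume conditions (A1)–(A5) stated in the context hold for some sequence $\lambda=\lambda_n$ of tuning parameters, with $n\tau^2\lambda_n^2\to\infty$, $\log p=o(n\tau^2\lambda_n^2)$ and $\tau\gamma^{-2}q=o(1)$. Assume further that there exists a positive constant $\kappa$ such that $$\lim_{n\to\infty}\ \min_{A\nsupseteq A_0,\ |A|\le K_n}\Bigl\{n^{-1}\bigl\|(\mathbf I_n-\mathbf P_A)\mathbf X_{A_0}\boldsymbol\beta^*_{A_0}\bigr\|^2\Bigr\}\ \ge\ \kappa .$$ If $C_n\to\infty$, $qC_n\log(p)=o(n)$ and $K_n^2\log(p)\log(n)=o(n)$, then the tuning parameter $\widehat\lambda$ selected by HBIC satisfies $$P(M_{\widehat\lambda}=A_0)\to1\qquad\text{as } n,p\to\infty .$$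
   Context: Model: for each $n$, $\mathbf y=\mathbf X\boldsymbol\beta^*+\boldsymbol\varepsilon$, where $\mathbf X$ is a nonrandom $n\times p$ matrix with columns $\mathbf x_{(1)},\dots,\mathbf x_{(p)}$ normalized so that $\mathbf x_{(j)}^T\mathbf x_{(j)}/n=1$, $\boldsymbol\beta^*\in\mathbb R^p$ is the unknown true parameter, and $\boldsymbol\varepsilon=(\varepsilon_1,\dots,\varepsilon_n)^T$. The quantities $p$ (which may greatly exceed $n$), $q,\lambda,\tau,\gamma,d_*,\mathbf X,\boldsymbol\beta^*$ may all depend on $n$. $A_0=\{j:\beta_j^*\ne0\}$, $q=|A_0|$, $d_*=\min\{|\beta_j^*|:\beta_j^*\neq0\}$. For an index set $A\subseteq\{1,\dots,p\}$, $\mathbf X_A$ is the submatrix of columns of $\mathbf X$ with index in $A$, $\mathbf v_A$ the subvector of $\mathbf v$, and $\mathbf P_A$ the projection matrix onto the column space of $\mathbf X_A$; $\mathbf I_n$ is the $n\times n$ identity. $\|\cdot\|$ is the Euclidean norm, $\|\cdot\|_1$ the $L_1$ norm. Penalty: $p_\lambda(|t|)=J_\lambda(|t|)+\lambda|t|$ with $J_\lambda(|\cdot|)$ a differentiable concave function; $\nabla J_\lambda(|t|)$ denotes the derivative of $t\mapsto J_\lambda(|t|)$ at $t$. The penalty is standardized so that $\dot p_\lambda(0+)=\lambda$, and for some constant $a_0>0$, $\dot p_\lambda(t)\le\lambda$ for $0<t<a_0\lambda$ and $\dot p_\lambda(t)=0$ for $t>a_0\lambda$. Calibrated CCCP solution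 path: with $$Q(\boldsymbol\beta\mid\boldsymbol\beta^{(k)},\lambda)=\tfrac1{2n}\|\mathbf y-\mathbf X\boldsymbol\beta\|^2+\sum_{j=1}^p\nabla J_\lambda(|\beta_j^{(k)}|)\beta_j+\lambda\sum_{j=1}^p|\beta_j|,$$ put $\boldsymbol\beta^{(0)}=\mathbf 0$, $\widehat{\boldsymbol\beta}^{(1)}(\lambda)=\arg\min_{\boldsymbol\beta}Q(\boldsymbol\beta\mid\boldsymbol\beta^{(0)},\tau\lambda)$, and $\widehat{\boldsymbol\beta}(\lambda)=\arg\min_{\boldsymbol\beta}Q(\boldsymbol\beta\mid\widehat{\boldsymbol\beta}^{(1)}(\lambda),\lambda)$, where $\tau>0$. The path is $\{\widehat{\boldsymbol\beta}(\lambda):\lambda>0\}$. HBIC: $M_\lambda=\{j:\widehat\beta_j(\lambda)\ne0\}$, $\widehat\sigma^2_\lambda=n^{-1}\|\mathbf y-\mathbf X\widehat{\boldsymbol\beta}(\lambda)\|^2$, and $$\mathrm{HBIC}(\lambda)=\log(\widehat\sigma_\lambda^2)+|M_\lambda|\frac{C_n\log(p)}{n},$$ where $C_n$ is a sequence of positive numbers. With $K_n>q$ (allowed to diverge) and $\Lambda_n=\{\lambda:|M_\lambda|\le K_n\}$, the selected tuning parameter is $\widehat\lambda=\arg\min_{\lambda\in\Lambda_n}\mathrm{HBIC}(\lambda)$. Conditions: (A1) There is a constant $C_1>0$ with $\lambda_{\min}(n^{-1}\mathbf X_{A_0}^T\mathbf X_{A_0})\ge C_1$ ($\lambda_{\min}$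 = smallest eigenvalue). (A2) $\varepsilon_1,\dots,\varepsilon_n$ are i.i.d. mean zero sub-Gaussian with scale factor $0<\sigma<\infty$: $E[\exp(t\varepsilon_i)]\le e^{\sigma^2t^2/2}$ for all $t$. (A3) $p_\lambda(t)$ is increasing and concave on $[0,\infty)$ with continuous derivative $\dot p_\lambda(t)$ on $(0,\infty)$; it admits the decomposition $p_\lambda(|t|)=J_\lambda(|t|)+\lambda|t|$, where $J_\lambda(|\cdot|)$ is a differentiable concave function, with $\nabla J_\lambda(|t|)=-\lambda\,\mathrm{sign}(t)$ for $|t|>a\lambda$, where $a>1$ is a constant, and $|\nabla J_\lambda(|t|)|\le|t|$ for $|t|\le b\lambda$, where $b\le a$ is a positive constant. (A4) $\gamma=\min_{\boldsymbol\delta\neq0,\ \|\boldsymbol\delta_{A_0^c}\|_1\le3\|\boldsymbol\delta_{A_0}\|_1}\frac{\|\mathbf X\boldsymbol\delta\|}{\sqrt n\,\|\boldsymbol\delta_{A_0}\|}>0$. (A5) $\lambda=o(d_* )$ and $\tau=o(1)$. *)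

(* Defs.v *)
From HB Require Import structures.
From mathcomp Require Import all_boot all_order all_algebra.
From mathcomp Require Import all_classical all_reals all_analysis.

Set Implicit Arguments.
Unset Strict Implicit.
Unset Printing Implicit Defensive.

Import Order.TTheory GRing.Theory Num.Theory.
Import numFieldNormedType.Exports.

Local Open Scope classical_set_scope.
Local Open Scope ring_scope.

Definition is_argmin {T : Type} {disp} {S : porderType disp}
    (D : set T) (f : T -> S) (x : T) : Prop :=
  D x /\ forall z, D z -> (f x <= f z)%O.

Section LinearAlgebra.
Context {R : realType}.

(* The library norm of a matrix is the sup norm. *)
Definition norm2 (m : nat) (v : 'cV[R]_m) : R :=
  Num.sqrt (\sum_(i < m) v i 0 ^+ 2).

Definition norm1 (m : nat) (v : 'cV[R]_m) : R := \sum_(i < m) `|v i 0|.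

Definition subvec (p : nat) (A : {set 'I_p}) (v : 'cV[R]_p) : 'cV[R]_(#|A|) :=
  rowsub (fun k : 'I_(#|A|) => enum_val k) v.

Definition subcols (n p : nat) (A : {set 'I_p}) (X : 'M[R]_(n, p)) :
    'M[R]_(n, #|A|) :=
  colsub (fun k : 'I_(#|A|) => enum_val k) X.

Definition supp (p : nat) (v : 'cV[R]_p) : {set 'I_p} :=
  [set j | v j 0 != 0]%SET.

(* B^T has as columns a basis of the column space of A, so no rank assumption
   on A is needed; colproj_tr, colproj_sub and colproj_id below characterize
   the orthogonal projection. *)
Definition colproj (n m : nat) (A : 'M[R]_(n, m)) : 'M[R]_n :=
  let B := row_base A^T in B^T *m invmx (B *m B^T) *m B.

Lemma row_free_gram_unit (r n : nat) (B : 'M[R]_(r, n)) :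
  row_free B -> B *m B^T \in unitmx.
Proof.
move=> Bfree; rewrite -row_free_unit -kermx_eq0.
apply/eqP/row_matrixP => i; rewrite row0.
have /sub_kermxP vG : (row i (kermx (B *m B^T)) <= kermx (B *m B^T))%MS.
  exact: row_sub.
set v := row i _ in vG *.
have vB : v *m B = 0.
  have /(congr1 (fun M : 'M[R]_1 => M 0 0)) : (v *m B) *m (v *m B)^T = 0.
    by rewrite trmx_mul -mulmxA [B *m _]mulmxA mulmxA vG mul0mx.
  rewrite !mxE => /eqP.
  rewrite psumr_eq0 => [/allP s0|j _]; last by rewrite !mxE -expr2 sqr_ge0.
  apply/rowP => j; have := s0 j (mem_index_enum _).
  by rewrite !mxE -expr2 /= sqrf_eq0 => /eqP ->.
by apply: (row_free_inj Bfree); rewrite vB mul0mx.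
Qed.

Lemma colproj_tr (n m : nat) (A : 'M[R]_(n, m)) : (colproj A)^T = colproj A.
Proof.
rewrite /colproj; move: (row_base _) => B.
by rewrite 2!trmx_mul trmxK trmx_inv trmx_mul trmxK mulmxA.
Qed.

Lemma colproj_sub (n m : nat) (A : 'M[R]_(n, m)) :
  ((colproj A)^T <= A^T)%MS.
Proof.
by rewrite colproj_tr (submx_trans (submxMl _ _))// eq_row_base.
Qed.

Lemma colproj_id (n m : nat) (A : 'M[R]_(n, m)) : colproj A *m A = A.
Proof.
apply: trmx_inj; rewrite trmx_mul colproj_tr /colproj.
have AB : (A^T <= row_base A^T)%MS by rewrite eq_row_base.
have := row_base_free A^T; move: (row_base _) AB => B /submxP[D DE] Bfree.
by rewrite [X in X *m _]DE -!mulmxA [B *m (_ *m _)]mulmxA mulKVmx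
  ?row_free_gram_unit.
Qed.

(* The infima below are minima whenever their index set is nonempty;
   min of the empty set is +oo. *)
Definition lambda_min (m : nat) (A : 'M[R]_m) : \bar R :=
  ereal_inf [set a%:E | a in [set a | eigenvalue A a]].

End LinearAlgebra.

Section Design.
Context {R : realType}.
Variables (n p : nat) (X : 'M[R]_(n, p)) (beta : 'cV[R]_p).

Definition normalized_columns : Prop :=
  forall j, ((col j X)^T *m col j X) 0 0 / n%:R = 1.

Definition min_signal : \bar R :=
  ereal_inf [set (`|beta j 0|)%:E | j in [set j | beta j 0 != 0]].

Definition RE_const : \bar R :=
  let A0 := supp beta in
  ereal_inf [set (norm2 (X *m d) / (Num.sqrt n%:R * norm2 (subvec A0 d)))%:E
            | d in [set d | d != 0 /\
                norm1 (subvec (~: A0) d) <= 3 * norm1 (subvec A0 d)]].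

Definition underfit_gap (K : R) : \bar R :=
  let A0 := supp beta in
  ereal_inf [set (n%:R^-1 * norm2 ((1%:M - colproj (subcols A X)) *m
                     (subcols A0 X *m subvec A0 beta)) ^+ 2)%:E
            | A in [set A : {set 'I_p} | ~~ (A0 \subset A) /\ #|A|%:R <= K]].

End Design.

Section Penalty.
Context {R : realType}.
Variables pen J : R -> R -> R.

Definition concave_on (D : set R) (f : R -> R) : Prop :=
  convex_function (E := R^o) D (fun t => - f t).

Definition gradJ (lam t : R) : R := derive1 (fun s : R => J lam `|s|) t.

Record penalty_standardized (a0 : R) : Prop := {
  pen_deriv0 : forall (lam : R), 0 < lam -> derive1 (pen lam) t @[t --> 0^'+] --> lam;
  pen_deriv_le : forall (lam t : R), 0 < lam -> 0 < t < a0 * lam ->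
    derive1 (pen lam) t <= lam;
  pen_deriv_eq0 : forall (lam t : R), 0 < lam -> a0 * lam < t ->
    derive1 (pen lam) t = 0
}.

(* Monotonicity is weak: the derivative vanishes beyond a0 * lam. *)
Record penalty_regular (a b : R) : Prop := {
  pen_incr : forall (lam s t : R), 0 < lam -> 0 <= s -> s <= t ->
    pen lam s <= pen lam t;
  pen_concave : forall (lam : R), 0 < lam -> concave_on `[0, +oo[ (pen lam);
  pen_derivable : forall (lam t : R), 0 < lam -> 0 < t -> derivable (pen lam) t 1;
  pen_C1 : forall (lam t : R), 0 < lam -> 0 < t ->
    {for t, continuous (derive1 (pen lam))};
  penE : forall (lam t : R), 0 < lam -> pen lam `|t| = J lam `|t| + lam * `|t|;
  J_derivable : forall (lam t : R), 0 < lam -> derivable (fun s : R => J lam `|s|) t 1;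
  J_concave : forall (lam : R), 0 < lam -> concave_on setT (fun s : R => J lam `|s|);
  gradJ_tail : forall (lam t : R), 0 < lam -> a * lam < `|t| ->
    gradJ lam t = - lam * Num.sg t;
  gradJ_near0 : forall (lam t : R), 0 < lam -> `|t| <= b * lam ->
    `|gradJ lam t| <= `|t|
}.

End Penalty.

Section Estimation.
Context {R : realType}.
Variables (n p : nat) (X : 'M[R]_(n, p)) (y : 'cV[R]_n).

Definition cccp_obj (J : R -> R -> R) (betak : 'cV[R]_p) (lam : R)
    (b : 'cV[R]_p) : R :=
  (2 * n%:R)^-1 * norm2 (y - X *m b) ^+ 2
  + \sum_(j < p) gradJ J lam (betak j 0) * b j 0
  + lam * \sum_(j < p) `|b j 0|.

(* The minimizers need not be unique when n < p: bhat1 and bhat select one for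
   every lam. *)
Definition cccp_path (J : R -> R -> R) (tau : R)
    (bhat1 bhat : R -> 'cV[R]_p) : Prop :=
  forall lam, 0 < lam ->
    is_argmin setT (cccp_obj J 0 (tau * lam)) (bhat1 lam) /\
    is_argmin setT (cccp_obj J (bhat1 lam) lam) (bhat lam).

Variable bhat : R -> 'cV[R]_p.

Definition sigma2_hat (lam : R) : R :=
  n%:R^-1 * norm2 (y - X *m bhat lam) ^+ 2.

(* Extended real valued, since ln 0 = 0 in the library whereas lne 0 = -oo. *)
Definition HBIC (C lam : R) : \bar R :=
  (lne (sigma2_hat lam)%:E +
   (#|supp (bhat lam)|%:R * (C * ln p%:R / n%:R))%:E)%E.

Definition tuning_range (K : R) : set R :=
  [set lam | 0 < lam /\ #|supp (bhat lam)|%:R <= K].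

(* The infimum of HBIC over a continuum of lam need not be attained for every
   realization; lamhat is constrained only when it is. *)
Definition selects_HBIC (C K lamhat : R) : Prop :=
  (exists lam, is_argmin (tuning_range K) (HBIC C) lam) ->
  is_argmin (tuning_range K) (HBIC C) lamhat.

End Estimation.

Section Probability.
Context {d : measure_display} {Omega : measurableType d} {R : realType}.
Variable P : probability Omega R.

Definition mutually_independent (n : nat) (Z : 'I_n -> {RV P >-> R}) : Prop :=
  forall B : 'I_n -> set R, (forall i, measurable (B i)) ->
    P (\bigcap_(i in setT) (Z i @^-1` B i)) =
    (\prod_(i < n) P (Z i @^-1` B i))%E.

(* The common law of the errors does not depend on n either. *)
Record subgaussian_errors (sigma : R)
    (eps : forall n : nat, 'I_n -> {RV P >-> R}) : Prop := {
  errors_independent : forall n, mutually_independent (eps n);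
  errors_identical : forall n m (i : 'I_n) (j : 'I_m) (B : set R),
    measurable B ->
    distribution P (eps n i) B = distribution P (eps m j) B;
  errors_mean0 : forall n (i : 'I_n), ('E_P[eps n i] = 0)%E;
  errors_subgaussian : forall n (i : 'I_n) (t : R),
    (mmt_gen_fun P (eps n i) t <= (expR (sigma ^+ 2 * t ^+ 2 / 2))%:E)%E
}.

Definition response (n p : nat) (X : 'M[R]_(n, p)) (beta : 'cV[R]_p)
    (eps : 'I_n -> {RV P >-> R}) (w : Omega) : 'cV[R]_n :=
  X *m beta + \col_i eps i w.

(* The selected minimizers depend on w in an arbitrary, possibly nonmeasurable
   way, so the probability of an event about them is an inner probability. *)
Definition inner_prob (E : set Omega) : \bar R :=
  ereal_sup [set P F | F in [set F | measurable F /\ F `<=` E]].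

Lemma inner_probE (E : set Omega) : measurable E -> inner_prob E = P E.
Proof.
move=> mE; apply/eqP; rewrite eq_le; apply/andP; split.
- apply: ge_ereal_sup => _ [F [mF FE] <-].
  by apply: le_measure => //; exact: mem_set.
- by apply: ereal_sup_ubound; exists E; [split|].
Qed.

End Probability.

(* Main.v *)
(* On an event of probability tending to 1, which only involves the errors, the
   tuning parameter lam_n minimizes HBIC over the admissible range, and every
   admissible parameter with another support has a strictly larger HBIC.

   The scores x_j^T eps being at most n tau lam_n / 2, the first Lasso step is
   within 12 tau lam_n q / gamma^2 = o(lam_n) of beta in l1 norm, so the second
   step penalizes no true coordinate and penalizes the others at a level close
   to lam_n; a dual certificate then identifies its minimizer with the least
   squares fit on the true support. A least squares fit on a larger support
   lowers the residual sum of squares by the squared norm of the projection of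
   eps on k = |A| - q directions. A sub-Gaussian chi-square bound and a union
   over all supports make this O(k log p) simultaneously, which the penalty
   k C_n log p dominates; a support missing a true coordinate pays the bias
   n kappa. Hence HBIC(lam_n) is minimal.

   The argument needs the mean squared error to be bounded away from 0. If the
   common law of the errors is degenerate then eps = 0 almost surely,
   HBIC(lam_n) = -oo, and a minimizer must fit the data exactly; a perturbation
   argument shows that the only exact fit on the path is beta. *)

Require Import Defs.
From HB Require Import structures.
From mathcomp Require Import all_boot all_order all_algebra.
From mathcomp Require Import all_classical all_reals all_analysis.
From mathcomp Require Import measurable_realfun ring lra.

Set Implicit Arguments.
Unset Strict Implicit.
Unset Printing Implicit Defensive.

Import Order.TTheory GRing.Theory Num.Theory.
Import numFieldNormedType.Exports.

Local Open Scope classical_set_scope.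
Local Open Scope ring_scope.

(** * Exponential moments of independent variables *)

Section Independence.
Import HBNNSimple.
Context {d : measure_display} {T : measurableType d} {R : realType}.
Variable P : probability T R.

(** Both sides are additive in [f] and continuous along increasing sequences, so the inequality
    passes from indicators to simple functions and, by monotone convergence, to nonnegative
    measurable [f]. In the application [G] is the product of the other factors. *)
Lemma le_integral_mul_comp (G : T -> R) (Z : {RV P >-> R}) (c : \bar R)
    (f : R -> R) :
  measurable_fun setT G -> (forall x, 0 <= G x) -> (0 <= c)%E ->
  (forall B, measurable B ->
    \int[P]_x (G x * \1_(Z @^-1` B) x)%:E <= c * P (Z @^-1` B))%E ->
  measurable_fun [set: R] f -> (forall x, 0 <= f x) ->
  (\int[P]_x (G x * f (Z x))%:E <= c * \int[P]_x (f (Z x))%:E)%E.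
Proof.
move=> mG G0 c0 H mf f0.
have mfE : measurable_fun [set: R] (EFin \o f) by exact/measurable_EFinP.
pose F := nnsfun_approx (measurableT : measurable [set: R]) mfE.
have F_cvg x : (F k x)%:E @[k --> \oo] --> (f x)%:E.
  by apply: (cvg_nnsfun_approx measurableT mfE) => //= y _; rewrite lee_fin; exact: f0.
have F_nd z m k : (m <= k)%N -> F m z <= F k z.
  by move=> mk; exact/lefP/(nd_nnsfun_approx measurableT mfE).
have F_le k x : F k x <= f x.
  have := F_cvg x.
  move=> /fine_cvgP[_] Fx.
  rewrite -(cvg_lim _ Fx)//.
  apply: (@nondecreasing_cvgn_le _ (F ^~ x) (@F_nd x)).
  by apply/cvg_ex; exists (f x).
have mZ (g : R -> R) : measurable_fun [set: R] g -> measurable_fun setT (g \o Z).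
  by move=> mg; exact: measurableT_comp.
have mF k : measurable_fun [set: R] (F k) by [].
have mGF k : measurable_fun setT (fun x => G x * F k (Z x)).
  by apply: measurable_funM => //; exact: mZ.
have -> : (\int[P]_x (G x * f (Z x))%:E =
           \int[P]_x limn (fun k => (G x * F k (Z x))%:E))%E.
  apply: eq_integral => x _; apply/esym/cvg_lim => //.
  by under eq_fun do rewrite EFinM; rewrite EFinM; exact: cvgeZl.
rewrite monotone_convergence//; last first.
- by move=> x _ m k mk; rewrite lee_fin ler_wpM2l// F_nd.
- by move=> k x _; rewrite lee_fin mulr_ge0.
- by move=> k; exact/measurable_EFinP.
apply: lime_le; first apply: ereal_nondecreasing_is_cvgn.
  move=> m k mk; apply: ge0_le_integral => //.
  - by move=> x _; rewrite lee_fin mulr_ge0.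
  - exact/measurable_EFinP.
  - exact/measurable_EFinP.
  - by move=> x _; rewrite lee_fin ler_wpM2l// F_nd.
near=> k.
have preE y : Z @^-1` (F k @^-1` [set y]) = (F k \o Z) @^-1` [set y] by [].
have mpre y : measurable (Z @^-1` (F k @^-1` [set y])).
  by rewrite -[X in measurable X]setTI; exact: measurable_funP.
apply: (@le_trans _ _ (c * \int[P]_x (F k (Z x))%:E)%E); last first.
  apply: lee_wpmul2l => //; apply: ge0_le_integral => //.
  - by move=> x _; rewrite lee_fin.
  - by apply/measurable_EFinP; exact: mZ.
  - by apply/measurable_EFinP; exact: mZ.
  - by move=> x _; rewrite lee_fin F_le.
have m1 y : measurable_fun setT
    (fun x => \1_(Z @^-1` (F k @^-1` [set y])) x : R).
  exact: measurable_indic.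
pose A := range (F k).
have fA : finite_set A by exact: fimfunP.
(* Splitting [F k] over its level sets reduces the claim to the hypothesis [H], one value [y] at a
   time. *)
have FE z : (F k z)%:E = (\sum_(y \in A) (y * \1_(F k @^-1` [set y]) z)%:E)%E.
  by rewrite fimfunE fsumEFin.
have y1_ge0 y z : 0 <= y * \1_(F k @^-1` [set y]) z.
  rewrite indicE; case: (boolP (z \in _)) => [|_]; last by rewrite mulr0.
  by rewrite inE /= => <-; rewrite mulr1.
have -> : (\int[P]_x (F k (Z x))%:E = \sum_(y \in A)
    \int[P]_x (y * \1_(Z @^-1` (F k @^-1` [set y])) x)%:E)%E.
  rewrite -ge0_integral_fsum//.
  - by apply: eq_integral => x _; rewrite FE.
  - by move=> y; apply/measurable_EFinP; apply: measurable_funM.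
  - by move=> y x _; rewrite lee_fin; exact: y1_ge0.
have -> : (\int[P]_x (G x * F k (Z x))%:E = \sum_(y \in A)
    \int[P]_x (y * (G x * \1_(Z @^-1` (F k @^-1` [set y])) x))%:E)%E.
  rewrite -ge0_integral_fsum//.
  - apply: eq_integral => x _; rewrite EFinM FE ge0_mule_fsumr.
      by apply: eq_fsbigr => y _; rewrite -EFinM mulrCA.
    by move=> y; rewrite lee_fin.
  - move=> y; apply/measurable_EFinP; apply: measurable_funM => //.
    exact: measurable_funM.
  - by move=> y x _; rewrite lee_fin mulrCA mulr_ge0//; exact: y1_ge0.
rewrite ge0_mule_fsumr; last first.
  by move=> y; apply: integral_ge0 => x _; rewrite lee_fin; exact: y1_ge0.
apply: lee_fsum => // y; move=> [z _ <-].
have Fz : 0 <= F k z by [].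
under eq_integral do rewrite EFinM.
rewrite ge0_integralZl_EFin//; last 2 first.
- by move=> x _; rewrite lee_fin mulr_ge0.
- by apply/measurable_EFinP; exact: measurable_funM.
under [in leRHS]eq_integral do rewrite EFinM.
rewrite ge0_integralZl_EFin//; last by apply/measurable_EFinP.
rewrite muleCA; apply: lee_wpmul2l; first by rewrite lee_fin.
rewrite integral_indic// setIT; exact: H.
Unshelve. all: by end_near. Qed.

(* The indicators of the independence assumption are replaced by nonnegative
   functions one index at a time. *)
Lemma le_integral_prod (n : nat) (Z : 'I_n -> {RV P >-> R})
    (f : 'I_n -> R -> R) :
  mutually_independent Z -> (forall i, measurable_fun [set: R] (f i)) ->
  (forall i x, 0 <= f i x) ->
  (\int[P]_x (\prod_i f i (Z i x))%:E <= \prod_i \int[P]_x (f i (Z i x))%:E)%E.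
Proof.
move=> indep mf f0.
(* The first [k] factors are already functions, the others still indicators: [k = 0] is independence
   and [k = n] is the claim. *)
pose g k (B : 'I_n -> set R) (i : 'I_n) z : R :=
  if (i < k)%N then f i z else \1_(B i) z.
have g_ge0 k B i z : 0 <= g k B i z.
  by rewrite /g; case: ifP => // _; rewrite indicE.
have mg k B i : measurable (B i) -> measurable_fun [set: R] (g k B i).
  rewrite /g => mB; case: (i < k)%N => //; exact: measurable_indic.
have mgZ k B i : measurable (B i) ->
    measurable_fun [set: T] (fun x => g k B i (Z i x)).
  by move=> /(mg k B i) m; exact: measurableT_comp.
suff main k (B : 'I_n -> set R) : (forall i, measurable (B i)) -> (k <= n)%N ->
    (\int[P]_x (\prod_i g k B i (Z i x))%:E <=
     \prod_i \int[P]_x (g k B i (Z i x))%:E)%E.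
  have gf i z : g n (fun=> setT) i z = f i z by rewrite /g ltn_ord.
  have := main n (fun=> setT) (fun=> measurableT) (leqnn n).
  congr (_ <= _)%E.
    by apply: eq_integral => x _; congr (_%:E); apply: eq_bigr => i _.
  by apply: eq_bigr => i _; apply: eq_integral => x _; rewrite gf.
elim: k B => [|k IH] B mB kn.
  rewrite le_eqVlt; apply/orP; left; apply/eqP.
  transitivity (P (\bigcap_(i in setT) (Z i @^-1` B i))).
    rewrite -[X in _ = P X]setIT -integral_indic//; last first.
      apply: fin_bigcap_measurable => // i _.
      by rewrite -[X in measurable X]setTI; exact: measurable_funP.
    apply: eq_integral => x _; congr (_%:E).
    rewrite [RHS]indicE; case: (boolP (x \in _)) => [|xB].
      rewrite inE => xB; apply: big1 => i _; rewrite /g ltn0 indicE mem_set//.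
      exact: xB.
    have [i iB] : exists i, ~ B i (Z i x).
      apply/existsNP => H; move/negP: xB; apply; rewrite inE => i _; exact: H.
    by rewrite (bigD1 i)//= {1}/g ltn0 indicE memNset// mul0r.
  rewrite indep//; apply: eq_bigr => i _.
  under [RHS]eq_integral do rewrite /g ltn0.
  rewrite -[X in P X = _]setIT -integral_indic//.
  by rewrite -[X in measurable X]setTI; exact: measurable_funP.
pose j := Ordinal kn.
pose G x := \prod_(i < n | i != j) g k B i (Z i x).
have gS i x : i != j -> g k.+1 B i x = g k B i x.
  move=> ij; rewrite /g ltnS leq_eqVlt.
  by rewrite -[k]/(nat_of_ord j) val_eqE (negbTE ij).
rewrite (bigD1 j)//= muleC.
under eq_integral => x _.
  rewrite (bigD1 j)//= {1}/g ltnSn mulrC.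
  under eq_bigr => i ij do rewrite gS//.
  over.
have -> : (\prod_(i < n | i != j) \int[P]_x (g k.+1 B i (Z i x))%:E =
           \prod_(i < n | i != j) \int[P]_x (g k B i (Z i x))%:E)%E.
  by apply: eq_bigr => i ij; apply: eq_integral => x _; rewrite gS.
have -> : (\int[P]_x (g k.+1 B j (Z j x))%:E = \int[P]_x (f j (Z j x))%:E)%E.
  by apply: eq_integral => x _; rewrite /g ltnSn.
have mgi i : measurable_fun [set: T] (fun x => g k B i (Z i x)) by exact: mgZ.
apply: (@le_integral_mul_comp G) => //.
- rewrite /G; under eq_fun do rewrite big_mkcond/=.
  by apply: measurable_prod => i _; case: (i != j).
- by move=> x; apply: prodr_ge0.
- by apply: prode_ge0 => i _; apply: integral_ge0 => x _; rewrite lee_fin.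
move=> B0 mB0.
(* The induction hypothesis holds for every family of sets; putting an arbitrary [B0] at index [j]
   gives the indicator inequality required by [le_integral_mul_comp]. *)
pose B' i := if i == j then B0 else B i.
have mB' i : measurable (B' i) by rewrite /B'; case: ifP.
have gB' i z : i != j -> g k B' i z = g k B i z.
  by move=> ij; rewrite /g /B' (negbTE ij).
have := IH B' mB' (ltnW kn).
rewrite [X in _ -> (_ <= X)%E]muleC.
rewrite [X in (_ <= X)%E -> _](bigD1 j)//=.
congr (_ <= _ * _)%E.
- apply: eq_integral => x _; congr (_%:E).
  rewrite (bigD1 j)//= {1}/g ltnn {1}/B' eqxx mulrC; congr (_ * _).
  by apply: eq_bigr => i ij; exact: gB'.
- rewrite -[X in _ = P X]setIT -integral_indic//; last first.
    by rewrite -[X in measurable X]setTI; exact: measurable_funP.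
  by apply: eq_integral => x _; rewrite /g ltnn /B' eqxx.
- by apply: eq_bigr => i ij; apply: eq_integral => x _; rewrite gB'.
Qed.

End Independence.

(** * Exponential moments of sums of squares *)

Section SubGaussian.
Context {d : measure_display} {T : measurableType d} {R : realType}.
Variable P : probability T R.

(** Take for [m] the integer nearest to |u|: (|u| - m)^2 <= 1/4 expands to u^2/2 <= 1/8 - m^2/2 + m
    |u|. The two exponentials cover both signs of [u]. *)
Lemma expR_sqr_le_nat (u : R) : exists m : nat,
  expR (u ^+ 2 / 2) <= expR (8^-1) * expR (- (m%:R ^+ 2 / 2)) *
    (expR (m%:R * u) + expR (- (m%:R * u))).
Proof.
have u0 : 0 <= `|u| + 2^-1 by rewrite addr_ge0.
exists (Num.truncn (`|u| + 2^-1)).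
have /andP[] := truncn_itv u0; move: (Num.truncn _) => N.
rewrite -[N.+1%:R]natr1; move: (N%:R) => m m1 m2.
have m0 : (`|u| - m) ^+ 2 <= 4^-1.
  have -> : 4^-1 = (2^-1) ^+ 2 :> R by field.
  rewrite -[leLHS]real_normK ?num_real// lerXn2r ?nnegrE//.
  by rewrite ler_norml; apply/andP; split; lra.
apply: (@le_trans _ _ (expR (8^-1 - m ^+ 2 / 2 + m * `|u|))).
  by rewrite ler_expR -[u ^+ 2]real_normK ?num_real//; nra.
rewrite 2!expRD ler_wpM2l ?mulr_ge0 ?expR_ge0//.
by have [u0'|u0'] := ger0P u; [rewrite lerDl | rewrite mulrN lerDr]; exact: expR_ge0.
Qed.

(* In \sum_m e^(1/8) e^(-m^2/2) 2 e^(m^2/4), the m-th term is at most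
   chi2_cst / 2^(m+1). *)
Definition chi2_cst : R := 4 * expR 1 * expR (8^-1).

Lemma chi2_cst_gt0 : 0 < chi2_cst.
Proof. by rewrite /chi2_cst !mulr_gt0// expR_gt0. Qed.

Lemma chi2_cst_ge1 : 1 <= chi2_cst.
Proof.
have e1 : 1 <= expR 1 :> R by apply: le_trans (expR_ge1Dx _); lra.
have e8 : 1 <= expR 8^-1 :> R by apply: le_trans (expR_ge1Dx _); lra.
by rewrite /chi2_cst -[leLHS]mulr1 ler_pM//; lra.
Qed.

(** The left side is 2 e^(1/8) e^(-m^2/4). From (m - 2)^2 >= 0 one gets m^2/4 >= m - 1, and e^(-1)
    <= 1/2 makes the weight geometric. *)
Lemma gauss_weight_le (m : nat) :
  expR (8^-1) * expR (- (m%:R ^+ 2 / 2)) * (expR (m%:R ^+ 2 / 4) *+ 2) <=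
  chi2_cst / (2 ^ m.+1)%:R :> R.
Proof.
rewrite -[X in _ * X <= _]mulr_natl mulrCA -mulrA -expRD.
have -> : - (m%:R ^+ 2 / 2) + m%:R ^+ 2 / 4 = - (m%:R ^+ 2 / 4) :> R by field.
apply: (@le_trans _ _ (2 * (expR 8^-1 * (expR 1 * expR (- 1) ^+ m)))).
  rewrite ler_pM2l// ler_pM2l ?expR_gt0// -expRM_natl -expRD ler_expR.
  by have := sqr_ge0 (m%:R - 2 : R); nra.
have e1 : expR (- 1) ^+ m <= (2 ^+ m)^-1 :> R.
  rewrite -exprVn lerXn2r ?nnegrE ?expR_ge0// expRN lef_pV2 ?posrE ?expR_gt0//.
  by apply: le_trans (expR_ge1Dx _); lra.
rewrite natrX exprS invfM /chi2_cst.
rewrite [leRHS](_ : _ = 2 * (expR 8^-1 * (expR 1 * (2 ^+ m)^-1))); last first.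
  have : (2 : R) ^+ m != 0 by rewrite expf_neq0.
  by move=> ?; field.
by rewrite ler_pM2l// !ler_pM2l ?expR_gt0.
Qed.

(* E exp(theta sum Y_i^2) is bounded by linearizing one square at a time:
   exp(u^2/2) is dominated by a series of exponentials of multiples of u. *)
Lemma mgf_sum_sqr (k : nat) (Y : 'I_k -> T -> R) (v th : R) :
  (forall i, measurable_fun setT (Y i)) -> 0 < th -> v * th = 4^-1 ->
  (forall c : 'I_k -> R, \int[P]_x (expR (\sum_i c i * Y i x))%:E <=
     (expR (v / 2 * \sum_i c i ^+ 2))%:E)%E ->
  (\int[P]_x (expR (\sum_i th * Y i x ^+ 2))%:E <= (chi2_cst ^+ k)%:E)%E.
Proof.
move=> mY th0 vth H.
(* Induction on the number [j] of coordinates whose exponent is already a square; the others carry a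
   linear form, and [N j c] is the squared norm of its coefficients. *)
pose h j (c : 'I_k -> R) (i : 'I_k) y : R :=
  if (i < j)%N then th * y ^+ 2 else c i * y.
pose N j (c : 'I_k -> R) : R := \sum_(i < k | ~~ (i < j)%N) c i ^+ 2.
have mh j c i : measurable_fun setT (fun x => h j c i (Y i x)).
  rewrite /h; case: (i < j)%N; apply: measurable_funM => //.
  exact: measurable_funX.
have mH j c (p : pred 'I_k) :
    measurable_fun setT (fun x => expR (\sum_(i | p i) h j c i (Y i x))).
  apply: measurableT_comp; first exact: measurable_expR.
  under eq_fun do rewrite big_mkcond.
  by apply: measurable_sum => i; case: (p i).
suff main j c : (j <= k)%N -> (\int[P]_x (expR (\sum_i h j c i (Y i x)))%:E <=
    (chi2_cst ^+ j * expR (v / 2 * N j c))%:E)%E.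
  have := main k (fun=> 0) (leqnn k).
  have -> : N k (fun=> 0) = 0 by apply: big1 => i _; rewrite expr0n.
  rewrite mulr0 expR0 mulr1; congr (_ <= _)%E.
  apply: eq_integral => x _; congr (expR _)%:E.
  by apply: eq_bigr => i _; rewrite /h ltn_ord.
elim: j c => [|j IH] c jk.
  rewrite expr0 mul1r; apply: le_trans (H c).
  by under eq_integral do under eq_bigr do rewrite /h ltn0.
pose i0 := Ordinal jk.
(* With this [r], th Y^2 = (r Y)^2 / 2, so [expR_sqr_le_nat] trades the new square for linear terms
   with coefficients m r and - m r. *)
pose r := Num.sqrt (2 * th).
have r2 : r ^+ 2 = 2 * th by rewrite sqr_sqrtr// mulr_ge0// ltW.
pose w m : R := expR 8^-1 * expR (- (m%:R ^+ 2 / 2)).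
have w0 m : 0 <= w m by rewrite mulr_ge0 ?expR_ge0.
pose cm t i := if i == i0 then t * r else c i.
pose F m x := w m * (expR (\sum_i h j (cm m%:R) i (Y i x)) +
                     expR (\sum_i h j (cm (- m%:R)) i (Y i x))).
have F0 m x : 0 <= F m x by rewrite mulr_ge0// addr_ge0 ?expR_ge0.
have mF m : measurable_fun setT (F m).
  by apply: measurable_funM => //; apply: measurable_funD; exact: (mH _ _ xpredT).
have hE x t : \sum_i h j (cm t) i (Y i x) =
    t * (r * Y i0 x) + \sum_(i < k | i != i0) h j.+1 c i (Y i x).
  rewrite (bigD1 i0)//= {1}/h ltnn /cm eqxx mulrA; congr (_ + _).
  apply: eq_bigr => i ii0; rewrite /h (negbTE ii0) ltnS [in RHS]leq_eqVlt.
  by rewrite -[X in _ == X]/(nat_of_ord i0) val_eqE (negbTE ii0).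
apply: (@le_trans _ _ (\int[P]_x (\sum_(0 <= m <oo) (F m x)%:E))%E).
  apply: ge0_le_integral => //.
  - by apply/measurable_EFinP; exact: (mH _ _ xpredT).
  - apply: ge0_emeasurable_sum => //.
      by move=> m x _ _; rewrite lee_fin.
    by move=> m _; exact/measurable_EFinP.
  move=> x _.
  have [m Hm] := expR_sqr_le_nat (r * Y i0 x).
  apply: (@le_trans _ _ (F m x)%:E); last first.
    apply: le_trans (@nneseries_lim_ge _ (fun m => (F m x)%:E) xpredT 0 m.+1 _).
      rewrite big_nat_recr//= leeDr//; apply: sume_ge0 => i _.
      by rewrite lee_fin.
    by move=> i _ _; rewrite lee_fin.
  rewrite lee_fin /F !hE !expRD -mulrDl mulrA (bigD1 i0)//= expRD.
  rewrite ler_wpM2r ?expR_ge0// {1}/h ltnSn mulNr; apply: le_trans Hm.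
  by rewrite exprMn r2 ler_expR; nra.
rewrite integral_nneseries//; last 2 first.
- by move=> m; exact/measurable_EFinP.
- by move=> m x _; rewrite lee_fin.
apply: (@le_trans _ _ (\sum_(0 <= m <oo)
  ((chi2_cst ^+ j * expR (v / 2 * N j.+1 c) * chi2_cst) / (2 ^ m.+1)%:R)%:E)%E);
  last first.
  apply: le_trans (epsilon_trick0 _ _) _.
    by rewrite !mulr_ge0 ?expR_ge0// ?exprn_ge0// ltW// chi2_cst_gt0.
  by rewrite lee_fin exprSr mulrAC.
apply: lee_nneseries.
  by move=> m _ _; apply: integral_ge0 => x _; rewrite lee_fin.
move=> m _.
have NE t : N j (cm t) = t ^+ 2 * r ^+ 2 + N j.+1 c.
  rewrite /N (bigD1 i0)/= ?ltnn// /cm eqxx exprMn; congr (_ + _).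
  apply: eq_big => [i|i /andP[_ /negbTE ->]//].
  rewrite -!leqNgt [in RHS]ltn_neqAle andbC; congr (_ && _).
  by rewrite -val_eqE/= eq_sym.
(* The coefficient t r costs v t^2 r^2 / 2 = v th t^2 = t^2/4 in the exponent, less than the weight
   t^2/2 gained from [w]. *)
have IHm t : (\int[P]_x (expR (\sum_i h j (cm t) i (Y i x)))%:E <=
    (chi2_cst ^+ j * expR (v / 2 * N j.+1 c) * expR (t ^+ 2 / 4))%:E)%E.
  apply: (le_trans (IH (cm t) (ltnW jk))).
  rewrite lee_fin NE r2 -[leRHS]mulrA -expRD ler_wpM2l//.
    by rewrite exprn_ge0// ltW// chi2_cst_gt0.
  by rewrite ler_expR; nra.
rewrite /F; under eq_integral do rewrite EFinM EFinD.
rewrite ge0_integralZl_EFin//; last 2 first.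
- by move=> x _; rewrite adde_ge0// lee_fin expR_ge0.
- by apply: emeasurable_funD; apply/measurable_EFinP; exact: (mH _ _ xpredT).
rewrite ge0_integralD//; last 2 first.
- by apply/measurable_EFinP; exact: (mH _ _ xpredT).
- by apply/measurable_EFinP; exact: (mH _ _ xpredT).
apply: (le_trans (lee_wpmul2l _ (leeD (IHm _) (IHm _)))).
  by rewrite lee_fin.
rewrite -EFinD -EFinM lee_fin sqrrN -mulr2n -mulrnAr mulrCA -[leRHS]mulrA.
rewrite ler_wpM2l//; last exact: gauss_weight_le.
by rewrite mulr_ge0 ?expR_ge0// exprn_ge0// ltW// chi2_cst_gt0.
Qed.

End SubGaussian.

(** * Tail bounds for the errors *)

Section Tails.
Context {d : measure_display} {T : measurableType d} {R : realType}.
Variable P : probability T R.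

Lemma markov_expR (h : T -> R) (a b : R) :
  measurable_fun setT h -> (\int[P]_x (expR (h x))%:E <= b%:E)%E ->
  (P [set x | (a < h x)%R] <= (expR (- a) * b)%:E)%E.
Proof.
move=> mh hb.
have mA : measurable [set x | (a < h x)%R].
  rewrite -[X in measurable X]setTI.
  exact: (measurable_fun_ltr (measurable_cst a) mh).
rewrite -[X in P X]setIT -integral_indic//.
have mexp : measurable_fun setT (fun x => (expR (h x))%:E).
  by apply/measurable_EFinP; apply: measurableT_comp => //; exact: measurable_expR.
rewrite EFinM; apply: (@le_trans _ _ ((expR (- a))%:E *
    \int[P]_x (expR (h x))%:E)%E); last first.
  by apply: lee_wpmul2l => //; rewrite lee_fin expR_ge0.
rewrite -ge0_integralZl_EFin ?expR_ge0//.
apply: ge0_le_integral => //.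
- by apply/measurable_EFinP; exact: measurable_indic.
- by apply: emeasurable_funM.
move=> x _; rewrite -EFinM lee_fin -expRD indicE.
case: (boolP (x \in _)) => [|_]; last exact: expR_ge0.
by rewrite inE/= => ax; rewrite -[leLHS]expR0 ler_expR; lra.
Qed.

Lemma finite_union_bound (I : finType) (E : I -> set T) (b : I -> R) :
  (forall i, measurable (E i)) -> (forall i, (P (E i) <= (b i)%:E)%E) ->
  measurable [set x | exists i, E i x] /\
  (P [set x | exists i, E i x] <= (\sum_i b i)%:E)%E.
Proof.
move=> mE Eb.
have -> : [set x | exists i, E i x] = \bigcup_(i in setT) E i.
  by apply/seteqP; split=> [x [i Ei]|x [i _ Ei]]; exists i.
have mU : measurable (\bigcup_(i in setT) E i) by exact: fin_bigcup_measurable.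
split=> //.
apply: le_trans.
  by apply: (@content_sub_fsum _ _ _ P I setT _ E) => //; exact: finite_finset.
rewrite -sumEFin fsbig_finite/=; last exact: finite_finset.
apply: (@le_trans _ _
    (\sum_(i <- finmap.enum_fset (fset_set [set: I])) (b i)%:E)%E).
  exact: lee_sum.
rewrite le_eqVlt; apply/orP; left; apply/eqP.
apply: perm_big; apply: uniq_perm; rewrite ?index_enum_uniq//.
move=> i; rewrite mem_index_enum in_fset_set; last exact: finite_finset.
by rewrite mem_setT.
Qed.

Section Errors.
Variables (n : nat) (Z : 'I_n -> {RV P >-> R}) (sigma : R).
Hypothesis sigma_gt0 : 0 < sigma.
Hypothesis indep : mutually_independent Z.
Hypothesis subg : forall i t,
  (mmt_gen_fun P (Z i) t <= (expR (sigma ^+ 2 * t ^+ 2 / 2))%:E)%E.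

Lemma le_prode (I : finType) (f g : I -> \bar R) :
  (forall i, 0 <= f i)%E -> (forall i, f i <= g i)%E ->
  (\prod_i f i <= \prod_i g i)%E.
Proof.
move=> f0 fg; suff /andP[] : (0 <= \prod_i f i <= \prod_i g i)%E by [].
elim/big_rec2 : _ => [|i x y _ /andP[y0 yx]]; first by rewrite lexx lee01.
by rewrite mule_ge0//= lee_pmul.
Qed.

Lemma mgf_linear (a : 'I_n -> R) :
  (\int[P]_x (expR (\sum_i a i * Z i x))%:E <=
   (expR (sigma ^+ 2 / 2 * \sum_i a i ^+ 2))%:E)%E.
Proof.
under eq_integral do rewrite expR_sum.
apply: (le_trans (le_integral_prod (f := fun i z => expR (a i * z)) indep _ _)).
- move=> i; apply: measurableT_comp; first exact: measurable_expR.
  exact: measurable_funM.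
- by move=> i x; exact: expR_ge0.
rewrite mulr_sumr expR_sum -prodEFin; apply: le_prode => i.
  by apply: integral_ge0 => x _; rewrite lee_fin expR_ge0.
rewrite -mulrA [_^-1 * _]mulrC mulrA; apply: le_trans (subg i (a i)).
rewrite /mmt_gen_fun unlock le_eqVlt; apply/orP; left; apply/eqP.
by apply: eq_integral => x _ /=; rewrite mulrC.
Qed.

Definition noise (x : T) : 'cV[R]_n := \col_i Z i x.

Lemma norm2_sqr (m : nat) (v : 'cV[R]_m) : norm2 v ^+ 2 = \sum_i v i 0 ^+ 2.
Proof. by rewrite sqr_sqrtr// sumr_ge0// => i _; exact: sqr_ge0. Qed.

Lemma mul_noiseE (k : nat) (U : 'M[R]_(k, n)) x i :
  (U *m noise x) i 0 = \sum_j U i j * Z j x.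
Proof. by rewrite mxE; apply: eq_bigr => j _; rewrite mxE. Qed.

Lemma measurable_mul_noise (k : nat) (U : 'M[R]_(k, n)) i :
  measurable_fun setT (fun x => (U *m noise x) i 0).
Proof.
under eq_fun do rewrite mul_noiseE.
by apply: measurable_sum => j; exact: measurable_funM.
Qed.

Lemma measurable_noise_sqr (k : nat) (U : 'M[R]_(k, n)) :
  measurable_fun setT (fun x => norm2 (U *m noise x) ^+ 2).
Proof.
under eq_fun do rewrite norm2_sqr.
apply: measurable_sum => i; apply: measurable_funX.
exact: measurable_mul_noise.
Qed.

Lemma measurable_noise_gt (k : nat) (U : 'M[R]_(k, n)) (t : R) :
  measurable [set x | t < norm2 (U *m noise x) ^+ 2].
Proof.
rewrite -[X in measurable X]setTI.
exact: (measurable_fun_ltr (measurable_cst _) (measurable_noise_sqr _)).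
Qed.

Lemma measurable_noise_lt (t : R) : measurable [set x | norm2 (noise x) ^+ 2 < t].
Proof.
rewrite -[X in measurable X]setTI.
have := measurable_noise_sqr 1%:M; under eq_fun do rewrite mul1mx.
by move=> m; exact: (measurable_fun_ltr m (measurable_cst _)).
Qed.

(** The coordinates of U eps may be dependent, but the linear form with coefficients c has variance
    factor sigma^2 |U^T c|^2 <= sigma^2 |c|^2, which is all that [mgf_sum_sqr] asks. The rate th =
    1/(4 sigma^2) is dictated by v th = 1/4. *)
Lemma noise_tail (k : nat) (U : 'M[R]_(k, n)) (t : R) :
  (forall c : 'cV[R]_k, norm2 (U^T *m c) <= norm2 c) ->
  (P [set x | t < norm2 (U *m noise x) ^+ 2]%R <=
   (expR (- (t / (4 * sigma ^+ 2))) * chi2_cst ^+ k)%:E)%E.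
Proof.
move=> U1; pose th := (4 * sigma ^+ 2)^-1.
have s2 : 0 < sigma ^+ 2 by rewrite exprn_gt0.
have th0 : 0 < th by rewrite invr_gt0 mulr_gt0.
have -> : [set x | t < norm2 (U *m noise x) ^+ 2] =
    [set x | t * th < th * norm2 (U *m noise x) ^+ 2].
  by apply/seteqP; split=> x /=; rewrite [t * th]mulrC ltr_pM2l.
apply: markov_expR.
  by apply: measurable_funM => //; exact: measurable_noise_sqr.
under eq_integral do rewrite norm2_sqr mulr_sumr.
apply: (@mgf_sum_sqr _ _ _ P k (fun i x => (U *m noise x) i 0) (sigma ^+ 2)) => //.
- by move=> i; exact: measurable_mul_noise.
- by rewrite /th; field; rewrite gt_eqF.
move=> c.
have cE x : \sum_i c i * (U *m noise x) i 0 =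
    \sum_j (U^T *m \col_i c i) j 0 * Z j x.
  under eq_bigr do rewrite mul_noiseE mulr_sumr.
  rewrite exchange_big; apply: eq_bigr => j _ /=.
  by rewrite mxE mulr_suml; apply: eq_bigr => i _; rewrite !mxE mulrA [_ * c i]mulrC.
under eq_integral do rewrite cE.
apply: (le_trans (mgf_linear _)); rewrite lee_fin ler_expR ler_pM2l ?divr_gt0//.
have -> : \sum_i c i ^+ 2 = norm2 (\col_i c i) ^+ 2.
  by rewrite norm2_sqr; apply: eq_bigr => i _; rewrite mxE.
by rewrite -norm2_sqr lerXn2r ?nnegrE ?sqrtr_ge0// U1.
Qed.

Lemma noise_family_tail (I : finType) (k : I -> nat)
    (U : forall i, 'M[R]_(k i, n)) (t : I -> R) :
  (forall i (c : 'cV[R]_(k i)), norm2 ((U i)^T *m c) <= norm2 c) ->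
  let E := [set x | exists i, t i < norm2 (U i *m noise x) ^+ 2] in
  measurable E /\
  (P E <= (\sum_i expR (- (t i / (4 * sigma ^+ 2))) * chi2_cst ^+ k i)%:E)%E.
Proof.
move=> U1; apply: finite_union_bound => [i|i]; last exact: noise_tail.
exact: measurable_noise_gt.
Qed.

(** A Chernoff bound with exp(-Z^2). It is useful when c < - ln rho, and keeps the mean squared
    error away from 0 for a nondegenerate law. *)
Lemma noise_lower_tail (rho c : R) : 0 <= rho ->
  (forall i, \int[P]_x (expR (- Z i x ^+ 2))%:E <= rho%:E)%E ->
  (P [set x | norm2 (noise x) ^+ 2 < c * n%:R]%R <=
   ((expR c * rho) ^+ n)%:E)%E.
Proof.
move=> rho0 H.
have -> : [set x | norm2 (noise x) ^+ 2 < c * n%:R] =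
    [set x | - (c * n%:R) < \sum_i - Z i x ^+ 2].
  apply/seteqP; split=> x /=; rewrite sumrN ltrN2 norm2_sqr.
    by under eq_bigr do rewrite mxE.
  by under [X in _ -> X < _]eq_bigr do rewrite mxE.
have -> : ((expR c * rho) ^+ n = expR (- - (c * n%:R)) * rho ^+ n)%R.
  by rewrite opprK expRM_natr exprMn.
apply: markov_expR.
  apply: measurable_sum => i; apply: measurableT_comp => //.
  exact: measurable_funX.
under eq_integral do rewrite expR_sum.
apply: (le_trans (le_integral_prod (f := fun i z => expR (- z ^+ 2)) indep _ _)).
- move=> i; apply: measurableT_comp; first exact: measurable_expR.
  by apply: measurableT_comp => //; exact: measurable_funX.
- by move=> i x; exact: expR_ge0.
apply: (@le_trans _ _ (\prod_(i < n) rho%:E)%E).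
  by apply: le_prode => i //; apply: integral_ge0 => x _; rewrite lee_fin expR_ge0.
by rewrite prodEFin lee_fin prodr_const card_ord.
Qed.

End Errors.

Lemma integral_expR_oppsqr (Z W : {RV P >-> R}) :
  (forall B, measurable B -> distribution P Z B = distribution P W B) ->
  (\int[P]_x (expR (- Z x ^+ 2))%:E = \int[P]_x (expR (- W x ^+ 2))%:E)%E.
Proof.
move=> ZW; pose f (z : R) : \bar R := (expR (- z ^+ 2))%:E.
have mf : measurable_fun [set: R] f.
  apply/measurable_EFinP; apply: measurableT_comp; first exact: measurable_expR.
  by apply: measurableT_comp => //; exact: measurable_funX.
have f0 y : (0 <= f y)%E by rewrite lee_fin expR_ge0.
transitivity (\int[distribution P Z]_y f y)%E.
  by rewrite ge0_integral_distribution.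
rewrite (@eq_measure_integral _ _ _ _ (distribution P W)).
  by rewrite ge0_integral_distribution.
by move=> A mA _; exact: ZW.
Qed.

Lemma integral_expR_oppsqr_le1 (Z : {RV P >-> R}) :
  exists rho : R, [/\ 0 <= rho, rho <= 1 &
    (\int[P]_x (expR (- Z x ^+ 2))%:E = rho%:E)%E].
Proof.
have mf : measurable_fun [set: R] (fun z : R => (expR (- z ^+ 2))).
  apply: measurableT_comp; first exact: measurable_expR.
  by apply: measurableT_comp => //; exact: measurable_funX.
have i0 : (0 <= \int[P]_x (expR (- Z x ^+ 2))%:E)%E.
  by apply: integral_ge0 => x _; rewrite lee_fin expR_ge0.
have i1 : (\int[P]_x (expR (- Z x ^+ 2))%:E <= 1)%E.
  apply: (@le_trans _ _ (\int[P]_x (cst 1%:E x))%E).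
    apply: ge0_le_integral => //.
    - by apply/measurable_EFinP; exact: (measurableT_comp mf).
    - by move=> x _; rewrite lee_fin -expR0 ler_expR oppr_le0 sqr_ge0.
  by rewrite integral_cst//= probability_setT mule1.
case: (\int[P]_x _)%E i0 i1 => //= r; rewrite !lee_fin => r0 r1.
by exists r.
Qed.

Lemma measurable_RV_neq0 (Z : {RV P >-> R}) : measurable [set x | Z x != 0].
Proof.
have -> : [set x | Z x != 0] = Z @^-1` (~` [set 0]).
  by apply/seteqP; split=> x /= /eqP.
rewrite -[X in measurable X]setTI; apply: measurable_funP => //.
exact: measurableC.
Qed.

(** 1 - exp(-Z^2) is nonnegative with zero integral, hence zero almost everywhere, and it vanishes
    only where Z does. So the value 1 of the integral detects degenerate errors. *)
Lemma ae_eq0_integral_expR (Z : {RV P >-> R}) :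
  (\int[P]_x (expR (- Z x ^+ 2))%:E = 1)%E ->
  P [set x | Z x != 0] = 0%E.
Proof.
move=> H.
have mf : measurable_fun [set: R] (fun z : R => (expR (- z ^+ 2))).
  apply: measurableT_comp; first exact: measurable_expR.
  by apply: measurableT_comp => //; exact: measurable_funX.
have mZ : measurable_fun setT (fun x => expR (- Z x ^+ 2)).
  exact: (measurableT_comp mf).
have h0 x : 0 <= 1 - expR (- Z x ^+ 2).
  by rewrite subr_ge0 -expR0 ler_expR oppr_le0 sqr_ge0.
have mh : measurable_fun setT (fun x => (1 - expR (- Z x ^+ 2))).
  exact: measurable_funB.
have : (\int[P]_x (1 - expR (- Z x ^+ 2))%:E = 0)%E.
  have : (\int[P]_x (1 - expR (- Z x ^+ 2))%:E + \int[P]_x (expR (- Z x ^+ 2))%:E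
          = 1)%E.
    rewrite -ge0_integralD//.
    - under eq_integral do rewrite -EFinD subrK.
      by rewrite integral_cst//= probability_setT mule1.
    - by move=> x _; rewrite lee_fin.
    - exact/measurable_EFinP.
    - exact/measurable_EFinP.
  rewrite H; case: (\int[P]_x _)%E => //= r; rewrite -EFinD => -[] r1.
  by congr (_%:E); lra.
rewrite (eq_integral (fun x => `|(1 - expR (- Z x ^+ 2))%:E|%E)); last first.
  by move=> x _; rewrite gee0_abs// lee_fin.
move=> /ae_eq_integral_abs => /(_ measurableT) [|A [mA PA sA]].
  exact/measurable_EFinP.
have mN := measurable_RV_neq0 Z.
apply: measure_negligible => //; exists A; split=> //.
move=> x /= Zx0; apply: sA => /= => /(_ Logic.I) /eqP.
rewrite eqe subr_eq0 -expR0 (inj_eq (@expR_inj R)) eq_sym oppr_eq0 sqrf_eq0.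
by rewrite (negbTE Zx0).
Qed.

End Tails.

(** * Least squares geometry *)

Section Euclidean.
Context {R : realType}.

Definition dotv (m : nat) (u v : 'cV[R]_m) : R := \sum_i u i 0 * v i 0.

Lemma dotvE m (u v : 'cV[R]_m) : dotv u v = (u^T *m v) 0 0.
Proof. by rewrite mxE; apply: eq_bigr => i _; rewrite mxE. Qed.

Lemma dotvC m (u v : 'cV[R]_m) : dotv u v = dotv v u.
Proof. by apply: eq_bigr => i _; rewrite mulrC. Qed.

Lemma dotvDr m (u v w : 'cV[R]_m) : dotv u (v + w) = dotv u v + dotv u w.
Proof. by rewrite -big_split; apply: eq_bigr => i _; rewrite !mxE mulrDr. Qed.

Lemma dotvZr m (c : R) (u v : 'cV[R]_m) : dotv u (c *: v) = c * dotv u v.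
Proof. by rewrite mulr_sumr; apply: eq_bigr => i _; rewrite !mxE mulrCA. Qed.

Lemma dotv0r m (u : 'cV[R]_m) : dotv u 0 = 0.
Proof. by apply: big1 => i _; rewrite [X in _ * X]mxE mulr0. Qed.

Lemma dotvNr m (u v : 'cV[R]_m) : dotv u (- v) = - dotv u v.
Proof. by rewrite -scaleN1r dotvZr mulN1r. Qed.

Lemma dotvBr m (u v w : 'cV[R]_m) : dotv u (v - w) = dotv u v - dotv u w.
Proof. by rewrite dotvDr dotvNr. Qed.

Lemma dotvDl m (u v w : 'cV[R]_m) : dotv (v + w) u = dotv v u + dotv w u.
Proof. by rewrite dotvC dotvDr !(dotvC u). Qed.

Lemma dotvBl m (u v w : 'cV[R]_m) : dotv (v - w) u = dotv v u - dotv w u.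
Proof. by rewrite dotvC dotvBr !(dotvC u). Qed.

Lemma dotv_mulmxl m k (A : 'M[R]_(m, k)) (u : 'cV[R]_k) (v : 'cV[R]_m) :
  dotv (A *m u) v = dotv u (A^T *m v).
Proof. by rewrite !dotvE trmx_mul mulmxA. Qed.

Lemma dotv_mulmxr m k (A : 'M[R]_(m, k)) (u : 'cV[R]_m) (v : 'cV[R]_k) :
  dotv u (A *m v) = dotv (A^T *m u) v.
Proof. by rewrite dotvC dotv_mulmxl dotvC. Qed.

Lemma dotv_ge0 m (u : 'cV[R]_m) : 0 <= dotv u u.
Proof. by apply: sumr_ge0 => i _; rewrite -expr2 sqr_ge0. Qed.

Lemma dotv_eq0 m (u : 'cV[R]_m) : dotv u u = 0 -> u = 0.
Proof.
move=> /eqP; rewrite psumr_eq0; last by move=> i _; rewrite -expr2 sqr_ge0.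
move=> /allP u0; apply/colP => i; have := u0 i (mem_index_enum _).
by rewrite -expr2 /= sqrf_eq0 mxE => /eqP.
Qed.

Lemma norm2_dotv m (u : 'cV[R]_m) : norm2 u ^+ 2 = dotv u u.
Proof. by rewrite sqr_sqrtr ?sumr_ge0// => i _; rewrite sqr_ge0. Qed.

Lemma norm2_ge0 m (u : 'cV[R]_m) : 0 <= norm2 u.
Proof. exact: sqrtr_ge0. Qed.

Lemma dotv_sqrD m (u v : 'cV[R]_m) :
  dotv (u + v) (u + v) = dotv u u + 2 * dotv u v + dotv v v.
Proof. by rewrite !dotvDl !dotvDr (dotvC v u); ring. Qed.

Lemma dotv_sqrB m (u v : 'cV[R]_m) :
  dotv (u - v) (u - v) = dotv u u - 2 * dotv u v + dotv v v.
Proof. by rewrite !dotvBl !dotvBr (dotvC v u); ring. Qed.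

Lemma dotv_CS m (u v : 'cV[R]_m) : dotv u v ^+ 2 <= dotv u u * dotv v v.
Proof.
have [v0|v_gt0] := eqVneq (dotv v v) 0.
  by rewrite (dotv_eq0 v0) !dotv0r expr0n mulr0.
have {}v_gt0 : 0 < dotv v v by rewrite lt_def v_gt0 dotv_ge0.
have := dotv_ge0 (dotv v v *: u - dotv u v *: v).
rewrite dotv_sqrB !dotvZr !(dotvC (_ *: _)) !dotvZr (dotvC v u).
rewrite (_ : _ - _ + _ = dotv v v * (dotv u u * dotv v v - dotv u v ^+ 2)); last by ring.
by rewrite pmulr_rge0// subr_ge0.
Qed.

(* The rows of U are orthogonal, of norm 1 or 0, so no rank assumption on B is
   needed; U^T U is the orthogonal projection onto the row space of B. *)
Lemma Gram_Schmidt k m (B : 'M[R]_(k, m)) : exists U : 'M[R]_(k, m),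
  (U^T *m U *m U^T = U^T) /\ (U^T *m U *m B^T = B^T).
Proof.
elim: k B => [|k IH] B.
  by exists 0; rewrite !trmx0 mulmx0; split=> //; apply/matrixP => i [].
pose b := usubmx (B : 'M[R]_(1 + k, m)); pose B1 := dsubmx (B : 'M[R]_(1 + k, m)).
have BE : B = col_mx b B1 by rewrite vsubmxK.
have [U1 [U1E U1B]] := IH B1.
have U1E' : U1 *m U1^T *m U1 = U1.
  by apply: trmx_inj; rewrite !trmx_mul trmxK mulmxA.
(* The part of the first row orthogonal to the rows of [U1]. If that row depends on the others then
   w = 0, and the normalized row [u] is zero. *)
pose w := b - b *m U1^T *m U1.
have wU1 : U1 *m w^T = 0.
  by rewrite /w raddfB/= mulmxBr !trmx_mul trmxK !mulmxA U1E' subrr.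
pose s := (Num.sqrt ((w *m w^T) 0 0))^-1.
pose u := s *: w.
have uT : u^T = s *: w^T by apply/matrixP => i j; rewrite !mxE.
have ww_ge0 : 0 <= (w *m w^T) 0 0.
  by have := dotv_ge0 w^T; rewrite dotvE trmxK.
have uw : w *m (u^T *m u) = w.
  have [w0|w0] := eqVneq ((w *m w^T) 0 0) 0.
    suff -> : w = 0 by rewrite mul0mx.
    apply: trmx_inj; rewrite trmx0; apply: dotv_eq0; by rewrite dotvE trmxK.
  have -> : u^T *m u = s ^+ 2 *: (w^T *m w).
    by rewrite uT -scalemxAl -scalemxAr scalerA expr2.
  rewrite -scalemxAr mulmxA [w *m w^T]mx11_scalar mul_scalar_mx scalerA.
  by rewrite /s exprVn sqr_sqrtr// mulVf// scale1r.
have uu : u^T *m u *m u^T = u^T.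
  by apply: trmx_inj; rewrite !trmx_mul trmxK {1}/u -scalemxAl uw.
have uU1 : U1 *m u^T = 0 by rewrite uT -scalemxAr wU1 scaler0.
have uU1' : u *m U1^T = 0 by apply: trmx_inj; rewrite trmx_mul trmxK trmx0.
suff H : let V := col_mx u U1 in V^T *m V *m V^T = V^T /\
    V^T *m V *m (col_mx b B1)^T = (col_mx b B1)^T.
  by exists (col_mx u U1); rewrite BE; exact: H.
rewrite /= !tr_col_mx mul_row_col !mul_mx_row; split; congr row_mx.
- by rewrite mulmxDl uu -mulmxA uU1 mulmx0 addr0.
- by rewrite mulmxDl U1E -mulmxA uU1' mulmx0 add0r.
- have bE : b^T = w^T + U1^T *m U1 *m b^T.
    by rewrite /w raddfB/= !trmx_mul trmxK mulmxA subrK.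
  rewrite mulmxDl {1}bE mulmxDr -[u^T *m u *m (_ *m _ *m _)]mulmxA.
  rewrite [u *m (_ *m _ *m _)]mulmxA [u *m (_ *m _)]mulmxA uU1' !mul0mx mulmx0 addr0.
  rewrite [RHS]bE; congr (_ + _).
  by apply: trmx_inj; rewrite !trmx_mul !trmxK uw.
- rewrite mulmxDl U1B -[X in _ *m X + _]U1B -mulmxA [u *m _]mulmxA.
  by rewrite [u *m (_ *m _)]mulmxA uU1' !mul0mx mulmx0 add0r.
Qed.

(** The difference |c|^2 - |U^T c|^2 is the square |c - U U^T c|^2. *)
Lemma partial_isometry_norm2 k m (U : 'M[R]_(k, m)) (c : 'cV[R]_k) :
  U^T *m U *m U^T = U^T -> norm2 (U^T *m c) <= norm2 c.
Proof.
move=> UE; rewrite -(@ler_pXn2r _ 2)// ?nnegrE ?norm2_ge0// !norm2_dotv.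
have := dotv_ge0 (c - U *m (U^T *m c)).
have -> : dotv (c - U *m (U^T *m c)) (c - U *m (U^T *m c)) =
    dotv c c - dotv (U^T *m c) (U^T *m c).
  rewrite dotv_sqrB (dotv_mulmxr U c) (dotv_mulmxl U (U^T *m c)) !mulmxA UE.
  by ring.
by rewrite subr_ge0.
Qed.

(** For [v] in the range of the projection U^T U, <e, v> = <U e, U v> and |U v| = |v|. The noise
    thus enters only through the k-dimensional vector U e. *)
Lemma partial_isometry_dotv k m (U : 'M[R]_(k, m)) (e v : 'cV[R]_m) :
  U^T *m U *m v = v -> dotv e v ^+ 2 <= norm2 (U *m e) ^+ 2 * dotv v v.
Proof.
move=> Uv; rewrite norm2_dotv.
have vv : dotv v v = dotv (U *m v) (U *m v) by rewrite dotv_mulmxl mulmxA Uv.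
by rewrite vv -[X in dotv e X]Uv -mulmxA dotv_mulmxr trmxK; exact: dotv_CS.
Qed.

End Euclidean.

(** * Regression on a subset of columns and restricted eigenvalues *)

Section Regression.
Context {R : realType}.
Variables (n p : nat) (X : 'M[R]_(n, p)).

Definition supported (A : {set 'I_p}) (a : 'cV[R]_p) : Prop :=
  forall j, j \notin A -> a j 0 = 0.

Lemma supported_supp a : supported (supp a) a.
Proof. by move=> j; rewrite inE negbK => /eqP. Qed.

Lemma mulmx_supported A a : supported A a ->
  X *m a = subcols A X *m subvec A a.
Proof.
move=> aA; apply/colP => i; rewrite !mxE.
rewrite (bigID (mem A))/= [X in _ + X]big1 ?addr0; last first.
  by move=> j jA; rewrite aA// mulr0.
by rewrite big_enum_val; apply: eq_bigr => k _; rewrite !mxE.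
Qed.

Lemma subcols_mulmx (A : {set 'I_p}) (c : 'cV[R]_(#|A|)) :
  exists2 a, supported A a & X *m a = subcols A X *m c.
Proof.
exists (\col_j \sum_(k | enum_val k == j) c k 0).
  move=> j jA; rewrite mxE big_pred0// => k; apply/negbTE.
  by apply: contra jA => /eqP <-; exact: enum_valP.
apply/colP => i; rewrite !mxE.
under eq_bigr do rewrite mxE mulr_sumr.
rewrite (exchange_big_dep predT)//=; apply: eq_bigr => k _.
by rewrite (big_pred1 (enum_val k)) ?mxE// => j; rewrite eq_sym.
Qed.

Lemma norm1_subvec (A : {set 'I_p}) (v : 'cV[R]_p) :
  norm1 (subvec A v) = \sum_(j in A) `|v j 0|.
Proof. by rewrite big_enum_val; apply: eq_bigr => k _; rewrite mxE. Qed.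

Lemma norm2_subvec (A : {set 'I_p}) (v : 'cV[R]_p) :
  norm2 (subvec A v) ^+ 2 = \sum_(j in A) v j 0 ^+ 2.
Proof.
rewrite sqr_sqrtr ?sumr_ge0// => [|i _]; last by rewrite sqr_ge0.
by rewrite [RHS]big_enum_val; apply: eq_bigr => k _; rewrite mxE.
Qed.

Lemma dotv_mulmx_col (u : 'cV[R]_n) (a : 'cV[R]_p) :
  dotv u (X *m a) = \sum_j dotv u (col j X) * a j 0.
Proof.
transitivity (\sum_j (X^T *m u) j 0 * a j 0); first by rewrite dotv_mulmxr.
apply: eq_bigr => j _; congr (_ * _).
by rewrite mxE; apply: eq_bigr => i _; rewrite !mxE mulrC.
Qed.

Lemma colproj_idem (m : nat) (B : 'M[R]_(n, m)) :
  colproj B *m colproj B = colproj B.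
Proof.
have /submxP[D DE] := colproj_sub B.
have PE : colproj B = B *m D^T by rewrite -[LHS]trmxK DE trmx_mul trmxK.
by rewrite {2}PE mulmxA colproj_id -PE.
Qed.

Lemma colproj_supported A a : supported A a ->
  colproj (subcols A X) *m (X *m a) = X *m a.
Proof. by move=> /mulmx_supported ->; rewrite mulmxA colproj_id. Qed.

Lemma colproj_range (A : {set 'I_p}) (u : 'cV[R]_n) : exists2 a, supported A a &
  colproj (subcols A X) *m u = X *m a.
Proof.
have /submxP[D DE] := colproj_sub (subcols A X).
have -> : colproj (subcols A X) = subcols A X *m D^T.
  by rewrite -[LHS]trmxK DE trmx_mul trmxK.
have [a aA aE] := subcols_mulmx (D^T *m u).
by exists a; rewrite // -mulmxA.
Qed.

Lemma dotv_colproj (m : nat) (B : 'M[R]_(n, m)) (u v : 'cV[R]_n) :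
  dotv (colproj B *m u) v = dotv u (colproj B *m v).
Proof. by rewrite dotv_mulmxl colproj_tr. Qed.

(** The bound on [RE_const] in product form: real valued, and without a division by the norm of h on
    [A], which may be 0. *)
Definition restricted_eigen (A : {set 'I_p}) (g : R) : Prop :=
  forall h : 'cV[R]_p,
    \sum_(j in ~: A) `|h j 0| <= 3 * \sum_(j in A) `|h j 0| ->
    g ^+ 2 * n%:R * \sum_(j in A) h j 0 ^+ 2 <= dotv (X *m h) (X *m h).

Lemma restricted_eigen_inj A g h : (0 < n)%N -> 0 < g ->
  restricted_eigen A g -> supported A h -> X *m h = 0 -> h = 0.
Proof.
move=> n0 g0 RE hA Xh0.
have : \sum_(j in ~: A) `|h j 0| <= 3 * \sum_(j in A) `|h j 0|.
  rewrite big1 ?mulr_ge0 ?sumr_ge0// => j; rewrite inE => jA.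
  by rewrite hA ?normr0.
move=> /RE; rewrite Xh0 dotv0r.
rewrite pmulr_rle0 ?mulr_gt0 ?exprn_gt0 ?ltr0n// => s0.
apply/colP => j; rewrite mxE.
have [jA|] := boolP (j \in A); last exact: hA.
have : \sum_(j in A) h j 0 ^+ 2 == 0.
  by rewrite eq_le s0 sumr_ge0// => i _; rewrite sqr_ge0.
rewrite psumr_eq0; last by move=> i _; rewrite sqr_ge0.
by move=> /allP/(_ j (mem_index_enum _)); rewrite jA/= sqrf_eq0 => /eqP.
Qed.

Lemma sqr_sum_le (A : {set 'I_p}) (v : 'cV[R]_p) :
  (\sum_(j in A) `|v j 0|) ^+ 2 <= #|A|%:R * \sum_(j in A) v j 0 ^+ 2.
Proof.
pose w : 'cV[R]_p := \col_j (j \in A)%:R.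
pose w' : 'cV[R]_p := \col_j (if j \in A then `|v j 0| else 0).
have := dotv_CS w w'.
have -> : dotv w w' = \sum_(j in A) `|v j 0|.
  rewrite [RHS]big_mkcond; apply: eq_bigr => j _; rewrite !mxE.
  by case: (j \in A); rewrite ?mul1r ?mul0r.
have -> : dotv w w = #|A|%:R.
  rewrite -sum1_card natr_sum [RHS]big_mkcond; apply: eq_bigr => j _; rewrite !mxE.
  by case: (j \in A); rewrite ?mul1r ?mul0r.
have -> // : dotv w' w' = \sum_(j in A) v j 0 ^+ 2.
rewrite [RHS]big_mkcond; apply: eq_bigr => j _; rewrite !mxE.
by case: (j \in A); rewrite ?mul0r// -expr2 real_normK ?num_real.
Qed.

(** For an empty support the cone is empty, [RE_const] is [+oo], and g = 1 is as good as any.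
    Otherwise a coordinate vector of the support lies in the cone, so the infimum is finite and
    serves as g. *)
Lemma RE_const_restricted_eigen (beta : 'cV[R]_p) (tau eta : R) :
  (0 < n)%N -> 0 < eta ->
  (0 < RE_const X beta)%E ->
  (tau%:E * (RE_const X beta)^-1 ^+ 2 * #|supp beta|%:R%:E < eta%:E)%E ->
  exists g, [/\ 0 < g, restricted_eigen (supp beta) g &
    tau * #|supp beta|%:R / g ^+ 2 < eta].
Proof.
move=> n0 eta0 gam0 Hlt; set A := supp beta in Hlt *.
have [q0|q0] := posnP #|A|.
  exists 1; split=> //; last by rewrite q0 mulr0 mul0r.
  move=> h _; rewrite big_pred0 ?mulr0 ?dotv_ge0// => j.
  by move/card0_eq: q0 => /(_ j).
have /card_gt0P[j0 j0A] := q0.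
pose e0 : 'cV[R]_p := \col_j (j == j0)%:R.
have e0_cone : e0 != 0 /\ norm1 (subvec (~: A) e0) <= 3 * norm1 (subvec A e0).
  split.
    apply/eqP => /colP/(_ j0); rewrite !mxE eqxx => /eqP; by rewrite oner_eq0.
  rewrite !norm1_subvec big1 ?mulr_ge0 ?sumr_ge0// => j; rewrite inE mxE => jA.
  by case: eqP jA => [->|_ _]; [rewrite j0A|rewrite normr0].
have gam_le h : h != 0 -> norm1 (subvec (~: A) h) <= 3 * norm1 (subvec A h) ->
    (RE_const X beta <=
     (norm2 (X *m h) / (Num.sqrt n%:R * norm2 (subvec A h)))%:E)%E.
  by move=> h0 hA; apply: ereal_inf_lbound; exists h.
have := gam_le _ e0_cone.1 e0_cone.2.
case: (RE_const X beta) gam0 Hlt gam_le => [g| |]//; rewrite lte_fin => g0 Hlt gam_le _.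
exists g; split=> //; last first.
  move: Hlt; rewrite inver gt_eqF// expe2 -!EFinM lte_fin.
  by rewrite -invfM -expr2 mulrAC.
move=> h hA; rewrite -norm2_dotv -norm2_subvec.
have [h0|h0] := eqVneq (norm2 (subvec A h)) 0.
  by rewrite h0 expr0n/= mulr0 exprn_ge0 ?norm2_ge0.
have {}h0 : 0 < norm2 (subvec A h) by rewrite lt_def h0 norm2_ge0.
have hn0 : h != 0.
  apply: contraL h0 => /eqP ->; rewrite -leNgt -(@ler_pXn2r _ 2)// ?nnegrE ?norm2_ge0//.
  by rewrite norm2_subvec big1 ?expr0n// => j _; rewrite mxE expr0n.
have := gam_le h hn0; rewrite !norm1_subvec => /(_ hA); rewrite lee_fin.
have sn : 0 < Num.sqrt n%:R :> R by rewrite sqrtr_gt0 ltr0n.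
rewrite ler_pdivlMr ?mulr_gt0// => H.
rewrite -[n%:R]sqr_sqrtr ?ler0n// -!exprMn -mulrA.
by rewrite lerXn2r// ?nnegrE ?norm2_ge0// !mulr_ge0 ?norm2_ge0// ltW.
Qed.

End Regression.

(** * The calibrated path and the oracle estimator *)

Section Path.
Context {R : realType}.
Variables (n p : nat) (X : 'M[R]_(n, p)) (beta : 'cV[R]_p) (e : 'cV[R]_n).
Variables (J : R -> R -> R) (g : R).
Hypotheses (n_gt0 : (0 < n)%N) (g_gt0 : 0 < g).
Let A0 := supp beta.
Let q : R := #|A0|%:R.
Let y := X *m beta + e.
Hypothesis RE : restricted_eigen X A0 g.

Let N : R := n%:R.
Let N_gt0 : 0 < N. Proof. by rewrite ltr0n. Qed.

Lemma dotv_score_le (mu : R) (h : 'cV[R]_p) :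
  (forall j, `|dotv e (col j X)| <= N * mu / 2) ->
  `|dotv e (X *m h)| <= N * mu / 2 * \sum_j `|h j 0|.
Proof.
move=> H; rewrite dotv_mulmx_col mulr_sumr.
apply: (le_trans (ler_norm_sum _ _ _)); apply: ler_sum => j _.
by rewrite normrM ler_wpM2r.
Qed.

Lemma sum_setC (A : {set 'I_p}) (F : 'I_p -> R) :
  \sum_j F j = \sum_(j in A) F j + \sum_(j in ~: A) F j.
Proof.
rewrite (bigID (mem A))/=; congr (_ + _).
by apply: eq_bigl => j; rewrite inE.
Qed.

(** As [gradJ] vanishes at 0, this is a plain Lasso. Comparing the objective at [b] and [beta], the
    scores absorb half of the penalty, leaving Q + N mu c <= 3 N mu a, where a and c are the l1
    norms of the error inside and outside the support. Hence c <= 3 a, the restricted eigenvalue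
    gives a <= 3 mu q / g^2, and 12 = 3 (1 + 3). *)
Lemma lasso_error (mu : R) (b : 'cV[R]_p) :
  0 < mu -> gradJ J mu 0 = 0 ->
  (forall j, `|dotv e (col j X)| <= N * mu / 2) ->
  is_argmin setT (cccp_obj X y J 0 mu) b ->
  \sum_j `|b j 0 - beta j 0| <= 12 * mu * q / g ^+ 2.
Proof.
move=> mu0 J0 He [_ /(_ beta Logic.I)].
rewrite /cccp_obj.
have lin0 (c : 'cV[R]_p) : \sum_(j < p) gradJ J mu ((0 : 'cV[R]_p) j 0) * c j 0 = 0.
  by apply: big1 => j _; rewrite mxE J0 mul0r.
rewrite !lin0 !addr0.
pose h := b - beta.
have hE j : h j 0 = b j 0 - beta j 0 by rewrite !mxE.
have <- : \sum_j `|h j 0| = \sum_j `|b j 0 - beta j 0|.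
  by apply: eq_bigr => j _; rewrite hE.
have -> : y - X *m beta = e by rewrite /y addrC addKr.
have -> : y - X *m b = e - X *m h by rewrite /h mulmxBr /y opprB addrCA addrA.
rewrite !norm2_dotv dotv_sqrB.
set Q := dotv (X *m h) (X *m h); set D := dotv e (X *m h).
set a := \sum_(j in A0) `|h j 0|; set c := \sum_(j in ~: A0) `|h j 0|.
have hac : \sum_j `|h j 0| = a + c by rewrite (sum_setC A0).
have a0 : 0 <= a by rewrite sumr_ge0.
have c0 : 0 <= c by rewrite sumr_ge0.
have DH : `|D| <= N * mu / 2 * (a + c) by rewrite -hac; exact: dotv_score_le.
have bh : c - a <= \sum_j `|b j 0| - \sum_j `|beta j 0|.
  rewrite -sumrB (sum_setC A0) addrC lerD//; last first.
    apply: ler_sum => j; rewrite !inE negbK => /eqP b0.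
    by rewrite hE b0 subr0 normr0 subr0.
  rewrite -sumrN; apply: ler_sum => j _; rewrite hE lerNl opprB.
  by rewrite distrC lerB_dist.
move=> H.
have {}H : Q + N * mu * c <= 3 * N * mu * a.
  move: DH; rewrite ler_norml => /andP[_ DH].
  have {}H : (2 * N)^-1 * (Q - 2 * D) + mu * (c - a) <= 0.
    have := ler_wpM2l (ltW mu0) bh; move: H; rewrite -/N; set E := dotv e e.
    lra.
  have := ler_wpM2l (ltW N_gt0) H; rewrite mulr0.
  have -> : N * ((2 * N)^-1 * (Q - 2 * D) + mu * (c - a)) =
      (Q - 2 * D) / 2 + N * mu * (c - a) by field; rewrite gt_eqF.
  lra.
have Q0 : 0 <= Q by exact: dotv_ge0.
have Nmu : 0 < N * mu by rewrite mulr_gt0.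
have ca : c <= 3 * a.
  by rewrite -(ler_pM2l Nmu); lra.
have := RE ca; rewrite -/N -/Q => HQ.
have g2 : 0 < g ^+ 2 by rewrite exprn_gt0.
have aq := sqr_sum_le A0 h; rewrite -/a -/q in aq.
have q0 : 0 <= q by rewrite ler0n.
have ga : g ^+ 2 * a ^+ 2 <= 3 * mu * q * a.
  have := ler_wpM2l (ltW (mulr_gt0 g2 N_gt0)) aq.
  have := ler_wpM2l q0 HQ.
  have : q * Q <= q * (3 * N * mu * a).
    by rewrite ler_wpM2l// (le_trans _ H)// lerDl mulr_ge0// ltW.
  by move=> H1 H2 H3; rewrite -(ler_pM2l N_gt0); lra.
rewrite hac ler_pdivlMr//.
have [a00|a_gt0] := eqVneq a 0.
  have -> : c = 0 by apply/le_anti; rewrite c0 andbT (le_trans ca)// a00 mulr0.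
  by rewrite a00 addr0 mul0r !mulr_ge0// ltW.
have {}a_gt0 : 0 < a by rewrite lt_def a_gt0.
have : g ^+ 2 * a <= 3 * mu * q.
  by rewrite -(ler_pM2r a_gt0); move: ga; lra.
have := ler_wpM2l (ltW g2) ca; lra.
Qed.

Let P0 := colproj (subcols A0 X).

Lemma oracle_residual_orth (bo a : 'cV[R]_p) :
  X *m bo = P0 *m y -> supported A0 a -> dotv (y - X *m bo) (X *m a) = 0.
Proof.
move=> -> aA; rewrite dotvBl dotv_colproj colproj_supported//.
exact: subrr.
Qed.

Lemma oracle_residualE (bo : 'cV[R]_p) :
  X *m bo = P0 *m y -> y - X *m bo = e - P0 *m e.
Proof.
move=> ->; rewrite /y mulmxDr colproj_supported; last exact: supported_supp.
by rewrite opprD addrACA subrr add0r.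
Qed.

(** Here X v = P0 e, so |X v|^2 = <e, X v> is at most N mu / 2 times the l1 norm of v. Being
    supported on A0, v lies in the cone, and the restricted eigenvalue closes the estimate. *)
Lemma oracle_error (mu : R) (bo : 'cV[R]_p) :
  0 < mu -> (forall j, `|dotv e (col j X)| <= N * mu / 2) ->
  supported A0 bo -> X *m bo = P0 *m y ->
  \sum_j `|bo j 0 - beta j 0| <= mu * q / (2 * g ^+ 2) /\
  dotv (X *m (bo - beta)) (X *m (bo - beta)) <= N * mu ^+ 2 * q / (4 * g ^+ 2).
Proof.
move=> mu0 He boA boE; pose v := bo - beta.
have vA : supported A0 v.
  by move=> j jA; rewrite !mxE boA// supported_supp// subrr.
have XvE : X *m v = P0 *m e.
  rewrite mulmxBr boE /y mulmxDr colproj_supported; last exact: supported_supp.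
  by rewrite addrC addKr.
have <- : \sum_j `|v j 0| = \sum_j `|bo j 0 - beta j 0|.
  by apply: eq_bigr => j _; rewrite !mxE.
rewrite -/v; set Q := dotv _ _; set a := \sum_j _.
have a0 : 0 <= a by rewrite sumr_ge0.
have QE : Q = dotv e (X *m v).
  by rewrite /Q {1}XvE dotv_colproj colproj_supported.
have Qa : Q <= N * mu / 2 * a.
  by rewrite QE (le_trans (ler_norm _))// dotv_score_le.
have c0 : \sum_(j in ~: A0) `|v j 0| = 0.
  by apply: big1 => j; rewrite inE => jA; rewrite vA// normr0.
have aE : a = \sum_(j in A0) `|v j 0| by rewrite /a (sum_setC A0) c0 addr0.
have := @RE v; rewrite c0 -aE => /(_ _); rewrite mulr_ge0// => /(_ isT).
rewrite -/N -/Q => HQ.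
have aq := sqr_sum_le A0 v; rewrite -aE -/q in aq.
have q0 : 0 <= q by rewrite ler0n.
have g2 : 0 < g ^+ 2 by rewrite exprn_gt0.
have ga : g ^+ 2 * a ^+ 2 <= mu / 2 * q * a.
  have H1 := ler_wpM2l (ltW (mulr_gt0 g2 N_gt0)) aq.
  have H2 := ler_wpM2l q0 HQ.
  have H3 := ler_wpM2l q0 Qa.
  by rewrite -(ler_pM2l N_gt0); lra.
have ga' : g ^+ 2 * a <= mu / 2 * q.
  have [a00|a_gt0] := eqVneq a 0; first by rewrite a00 mulr0 !mulr_ge0// ltW.
  have {}a_gt0 : 0 < a by rewrite lt_def a_gt0.
  by rewrite -(ler_pM2r a_gt0); move: ga; lra.
split; rewrite ler_pdivlMr ?mulr_gt0//; first by move: ga'; lra.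
have H1 := ler_wpM2l (ltW g2) Qa.
have H2 := ler_wpM2l (ltW (mulr_gt0 N_gt0 mu0)) ga'.
by move: H1 H2; lra.
Qed.

Hypothesis Xcol : forall j, dotv (col j X) (col j X) = N.

(** The residual is e - X (bo - beta). Its first term contributes N lam / 4 since tau <= 1/2; the
    second contributes as much, by Cauchy-Schwarz and the prediction error of [oracle_error]. *)
Lemma oracle_residual_score (lam tau : R) (bo : 'cV[R]_p) j :
  0 < tau -> tau <= 2^-1 -> 0 < lam -> tau * q / g ^+ 2 <= 2^-1 ->
  (forall j, `|dotv e (col j X)| <= N * (tau * lam) / 2) ->
  supported A0 bo -> X *m bo = P0 *m y ->
  `|dotv (y - X *m bo) (col j X)| <= N * lam / 2.
Proof.
move=> tau0 tau2 lam0 tq He boA boE.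
have [_ HQ] := oracle_error (mulr_gt0 tau0 lam0) He boA boE.
have -> : y - X *m bo = e - X *m (bo - beta).
  by rewrite mulmxBr /y opprB addrCA addrA.
rewrite dotvBl; apply: (le_trans (ler_normB _ _)).
have h1 : `|dotv e (col j X)| <= N * lam / 4.
  apply: (le_trans (He j)).
  have := ler_wpM2l (ltW (mulr_gt0 N_gt0 lam0)) tau2; lra.
have h2 : `|dotv (X *m (bo - beta)) (col j X)| <= N * lam / 4.
  rewrite -(@ler_pXn2r _ 2)// ?nnegrE ?normr_ge0//; last first.
    by rewrite divr_ge0// mulr_ge0// ltW.
  rewrite real_normK ?num_real//; apply: (le_trans (dotv_CS _ _)); rewrite Xcol.
  apply: (le_trans (ler_wpM2r (ltW N_gt0) HQ)).
  have -> : N * (tau * lam) ^+ 2 * q / (4 * g ^+ 2) * N =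
     N ^+ 2 * lam ^+ 2 / 4 * (tau * (tau * q / g ^+ 2)).
    by field; rewrite gt_eqF.
  have -> : (N * lam / 4) ^+ 2 = N ^+ 2 * lam ^+ 2 / 4 * (2^-1 * 2^-1) by field.
  have q0 : 0 <= q by rewrite ler0n.
  apply: ler_wpM2l; first by rewrite divr_ge0// mulr_ge0// exprn_ge0// ltW.
  apply: ler_pM => //; first exact: ltW.
  by rewrite divr_ge0 ?mulr_ge0 ?exprn_ge0// ltW.
lra.
Qed.

(** Dual certificate. On A0 the penalty increment from [bo] to [b] is lam (|b_j| - s b_j) >= 0. Off
    A0 it is at least (3/4) lam |b_j|, of which the residual score takes back at most half of lam
    |b_j|. So the objective grows by at least Q / (2 N) plus (lam / 4) |b_j| summed off A0;
    minimality annihilates both, and [X] is injective on vectors supported on A0. *)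
Lemma weighted_lasso_oracle (lam : R) (b1 b bo : 'cV[R]_p) :
  0 < lam -> supported A0 bo -> X *m bo = P0 *m y ->
  (forall j, j \in A0 ->
    exists2 s, gradJ J lam (b1 j 0) = - lam * s & `|s| <= 1 /\ s * bo j 0 = `|bo j 0|) ->
  (forall j, j \notin A0 -> `|gradJ J lam (b1 j 0)| <= lam / 4) ->
  (forall j, j \notin A0 -> `|dotv (y - X *m bo) (col j X)| <= N * lam / 2) ->
  is_argmin setT (cccp_obj X y J b1 lam) b -> b = bo.
Proof.
move=> lam0 boA boE gA gN rN [_ /(_ bo Logic.I)]; rewrite /cccp_obj.
pose h := b - bo; pose r := y - X *m bo.
have -> : y - X *m b = r - X *m h by rewrite /h mulmxBr /r opprB addrA subrK.
rewrite -/r !norm2_dotv dotv_sqrB.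
set Q := dotv (X *m h) (X *m h); set D := dotv r (X *m h).
set w := fun j => gradJ J lam (b1 j 0).
move=> H.
have DE : D = \sum_(j in ~: A0) dotv r (col j X) * b j 0.
  rewrite /D dotv_mulmx_col (sum_setC A0) big1 ?add0r.
    apply: eq_bigr => j; rewrite inE => jA.
    by rewrite !mxE boA// subr0.
  move=> j jA; suff -> : dotv r (col j X) = 0 by rewrite mul0r.
  rewrite -[col j X](_ : X *m delta_mx j 0 = _) ?colE//.
  apply: oracle_residual_orth => // i iA; rewrite mxE.
  by case: eqP iA => [->|]; rewrite ?jA.
pose f j := w j * b j 0 + lam * `|b j 0| - (w j * bo j 0 + lam * `|bo j 0|).
have fA j : j \in A0 -> 0 <= f j.
  move=> jA; have [s ws [s1 sb]] := gA j jA.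
  rewrite /f /w ws -sb.
  have : s * b j 0 <= `|b j 0|.
    by rewrite (le_trans (ler_norm _))// normrM ler_piMl.
  move=> /(ler_wpM2l (ltW lam0)); lra.
have H2 : Q / 2 - D + N * \sum_j f j <= 0.
  have fE : \sum_j f j = \sum_j w j * b j 0 + lam * \sum_j `|b j 0| -
      (\sum_j w j * bo j 0 + lam * \sum_j `|bo j 0|).
    by rewrite sumrB !big_split/= !mulr_sumr.
  have : (2 * N)^-1 * (Q - 2 * D) + \sum_j f j <= 0.
    by rewrite fE; move: H; rewrite -/N; set E := dotv r r; lra.
  move=> /(ler_wpM2l (ltW N_gt0)); rewrite mulr0; congr (_ <= _).
  by field; rewrite gt_eqF.
have H3 : Q / 2 + N * (lam / 4 * \sum_(j in ~: A0) `|b j 0|) <= 0.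
  apply: le_trans H2.
  suff : N * (lam / 4 * \sum_(j in ~: A0) `|b j 0|) <= - D + N * \sum_j f j by lra.
  rewrite (sum_setC A0 f) mulrDr DE.
  have : 0 <= N * \sum_(j in A0) f j by apply: mulr_ge0; [exact: ltW | exact: sumr_ge0].
  suff : N * (lam / 4 * \sum_(j in ~: A0) `|b j 0|) <=
    - (\sum_(j in ~: A0) dotv r (col j X) * b j 0) + N * \sum_(j in ~: A0) f j by lra.
  rewrite -sumrN !mulr_sumr -big_split/=; apply: ler_sum => j.
  rewrite inE => jA; rewrite /f boA// normr0 !mulr0 addr0 subr0.
  have e1 : dotv r (col j X) * b j 0 <= N * lam / 2 * `|b j 0|.
    by rewrite (le_trans (ler_norm _))// normrM ler_wpM2r// rN.
  have e2 : - (lam / 4 * `|b j 0|) <= w j * b j 0.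
    have : `|w j * b j 0| <= lam / 4 * `|b j 0| by rewrite normrM ler_wpM2r// gN.
    by rewrite ler_norml => /andP[].
  have := ler_wpM2l (ltW N_gt0) e2; move: e1; lra.
have Q0 : 0 <= Q by exact: dotv_ge0.
have s0 : 0 <= \sum_(j in ~: A0) `|b j 0| by rewrite sumr_ge0.
have s0' : 0 <= N * (lam / 4 * \sum_(j in ~: A0) `|b j 0|).
  by rewrite !mulr_ge0// ltW.
have Qz : Q = 0 by lra.
have sz : \sum_(j in ~: A0) `|b j 0| = 0.
  have : N * (lam / 4 * \sum_(j in ~: A0) `|b j 0|) == 0 by apply/eqP; lra.
  have l4 : 0 < lam / 4 by rewrite divr_gt0.
  by rewrite mulf_eq0 (gt_eqF N_gt0) mulf_eq0 (gt_eqF l4) => /eqP.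
have bA : supported A0 b.
  move=> j jA; move/eqP: sz; rewrite psumr_eq0// => /allP/(_ j (mem_index_enum _)).
  by rewrite inE jA/= normr_eq0 => /eqP.
apply/eqP; rewrite -subr_eq0; apply/eqP.
apply: (restricted_eigen_inj n_gt0 g_gt0 RE).
  by move=> j jA; rewrite !mxE boA// bA// subrr.
exact: dotv_eq0.
Qed.

End Path.

(** * The two steps at one tuning parameter *)

Section PathOracle.
Context {R : realType}.
Variables (n p : nat) (X : 'M[R]_(n, p)) (beta : 'cV[R]_p) (e : 'cV[R]_n).
Variables (pen J : R -> R -> R) (a b g tau lam : R) (b1 b2 : 'cV[R]_p).
Hypotheses (n_gt0 : (0 < n)%N) (g_gt0 : 0 < g).
Let A0 := supp beta.
Let q : R := #|A0|%:R.
Let y := X *m beta + e.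
Let N : R := n%:R.
Hypothesis RE : restricted_eigen X A0 g.
Hypothesis Xcol : forall j, dotv (col j X) (col j X) = N.
Hypothesis b_gt0 : 0 < b.
Hypothesis reg : penalty_regular pen J a b.
Hypotheses (lam_gt0 : 0 < lam) (tau_gt0 : 0 < tau).
Hypotheses (ratio_b : 12 * (tau * q / g ^+ 2) <= b).
Hypotheses (ratio_4 : 12 * (tau * q / g ^+ 2) <= 4^-1).
Hypothesis small_scores : forall j, `|dotv e (col j X)| <= N * (tau * lam) / 2.
Hypothesis argmin1 : is_argmin setT (cccp_obj X y J 0 (tau * lam)) b1.
Hypothesis argmin2 : is_argmin setT (cccp_obj X y J b1 lam) b2.

Lemma gradJ0 mu : 0 < mu -> gradJ J mu 0 = 0.
Proof.
move=> mu0; apply/eqP; rewrite -normr_le0 -[leRHS](@normr0 _ R).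
by apply: (gradJ_near0 reg mu0); rewrite normr0 mulr_ge0// ltW.
Qed.

Lemma stage1_error j : `|b1 j 0 - beta j 0| <= 12 * (tau * q / g ^+ 2) * lam.
Proof.
have mu0 : 0 < tau * lam by rewrite mulr_gt0.
have := lasso_error n_gt0 g_gt0 RE mu0 (gradJ0 mu0) small_scores argmin1.
have -> : 12 * (tau * lam) * #|supp beta|%:R / g ^+ 2 =
    12 * (tau * q / g ^+ 2) * lam by rewrite /q /A0; field; rewrite gt_eqF.
apply: le_trans; rewrite (bigD1 j)//= lerDl sumr_ge0//.
Qed.

Lemma stage1_error_le j : `|b1 j 0 - beta j 0| <= lam / 4.
Proof.
apply: (le_trans (stage1_error j)); rewrite mulrC.
by apply: ler_wpM2l; first exact: ltW.
Qed.

(** Off the support b1_j is its own error, small enough to fall in the range where [gradJ_near0]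
    bounds the gradient by |b1_j|. *)
Lemma stage1_grad j : j \notin A0 -> `|gradJ J lam (b1 j 0)| <= lam / 4.
Proof.
rewrite inE negbK => /eqP bj0.
have h1 := stage1_error j; have h2 := stage1_error_le j.
rewrite bj0 subr0 in h1 h2.
apply: le_trans h2; apply: (gradJ_near0 reg lam_gt0).
by apply: (le_trans h1); rewrite ler_wpM2r// ltW.
Qed.

(** A signal of size (a + 2) lam survives errors of lam / 4: |b1_j| exceeds a lam, where
    [gradJ_tail] cancels the l1 penalty, and bo_j is nonzero with the sign of b1_j. That sign is the
    certificate s. *)
Lemma path_oracle :
  tau <= 2^-1 -> 1 < a -> (forall j, j \in A0 -> (a + 2) * lam <= `|beta j 0|) ->
  X *m b2 = colproj (subcols A0 X) *m y /\ supp b2 = A0.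
Proof.
move=> tau2 a1 betaA.
have [bo boA boE] := colproj_range X A0 y.
have {}boE : X *m bo = colproj (subcols A0 X) *m y by rewrite boE.
have q0 : 0 <= q by rewrite ler0n.
have g2 : 0 < g ^+ 2 by rewrite exprn_gt0.
have [bo_err _] := oracle_error n_gt0 g_gt0 RE (mulr_gt0 tau_gt0 lam_gt0)
  small_scores boA boE.
have boj j : `|bo j 0 - beta j 0| <= lam / 4.
  apply: (@le_trans _ _ (\sum_j `|bo j 0 - beta j 0|)).
    by rewrite (bigD1 j)//= lerDl sumr_ge0.
  apply: (le_trans bo_err).
  have -> : tau * lam * #|supp beta|%:R / (2 * g ^+ 2) =
    2^-1 * (tau * q / g ^+ 2) * lam by rewrite /q /A0; field; rewrite gt_eqF.
  have : tau * q / g ^+ 2 <= 2^-1 by have := ratio_4; lra.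
  by move=> /(ler_wpM2l (ltW lam_gt0)); lra.
have lam0 := lam_gt0.
have sgn j : j \in A0 -> a * lam < `|b1 j 0| /\
    Num.sg (b1 j 0) * bo j 0 = `|bo j 0| /\ bo j 0 != 0.
  move=> jA; have := betaA j jA.
  have := boj j; have := stage1_error_le j.
  have al : lam < a * lam by rewrite -[X in X < _]mul1r ltr_pM2r.
  rewrite !ler_norml => /andP[u1 u2] /andP[v1 v2].
  have [bp|bn|<-] := ltgtP 0 (beta j 0).
  - rewrite (gtr0_norm bp) => H.
    have bo0 : 0 < bo j 0 by lra.
    have b10 : 0 < b1 j 0 by lra.
    rewrite (gtr0_norm b10) gtr0_sg// mul1r gtr0_norm// gt_eqF//.
    by split; [lra|split].
  - rewrite (ltr0_norm bn) => H.
    have bo0 : bo j 0 < 0 by lra.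
    have b10 : b1 j 0 < 0 by lra.
    rewrite (ltr0_norm b10) ltr0_sg// mulN1r ltr0_norm// lt_eqF//.
    by split; [lra|split].
  - by rewrite normr0 => H; exfalso; lra.
have b2E : b2 = bo.
  apply: (weighted_lasso_oracle n_gt0 g_gt0 RE lam_gt0 boA boE _ _ _ argmin2).
  - move=> j jA; have [h1 [h2 h3]] := sgn j jA.
    exists (Num.sg (b1 j 0)); first exact: (gradJ_tail reg).
    by split=> //; rewrite normr_sg; case: (_ != 0).
  - exact: stage1_grad.
  - move=> j jA; apply: (oracle_residual_score n_gt0 g_gt0 RE Xcol j tau_gt0) => //.
    by have := ratio_4; rewrite /q /A0; lra.
split; first by rewrite b2E.
apply/setP => j; rewrite inE b2E; apply/idP/idP.
  by apply: contraR => /boA ->.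
by move=> /sgn[_ []].
Qed.

(** Meant for the selected parameter, known only to be positive and to fit exactly. Once [b2] is
    supported on A0, injectivity of [X] there forces b2 = beta. *)
Lemma zero_noise_supp : e = 0 -> y = X *m b2 -> supp b2 = A0.
Proof.
move=> e0 yE.
have b2A : supported A0 b2.
  move=> j jA; apply/eqP/negPn/negP => bj0.
  (* Moving b2_j towards 0 by t leaves a residual t * x_j, and so changes the
     objective by at most t^2 / 2 - (3 / 4) lam t. *)
  pose s := Num.sg (b2 j 0).
  pose t := Num.min `|b2 j 0| lam.
  have t0 : 0 < t by rewrite lt_min normr_gt0 bj0.
  have tl : t <= lam by rewrite ge_min lexx orbT.
  have tb : t <= `|b2 j 0| by rewrite ge_min lexx.
  pose b' := b2 - (t * s) *: delta_mx j 0.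
  have b'j : b' j 0 = b2 j 0 - t * s by rewrite !mxE !eqxx/= mulr1.
  have b'i i : i != j -> b' i 0 = b2 i 0.
    by move=> ij; rewrite !mxE (negbTE ij) mulr0 subr0.
  have [_ /(_ b' Logic.I)] := argmin2.
  rewrite /cccp_obj.
  have -> : y - X *m b' = (t * s) *: col j X.
    by rewrite yE mulmxBr opprB addrC subrK -scalemxAr colE.
  have -> : y - X *m b2 = 0 by rewrite yE subrr.
  have ss : s * s = 1.
    by rewrite -expr2 /s sqr_sg bj0.
  rewrite !norm2_dotv dotvZr dotvC dotvZr Xcol dotv0r.
  rewrite (bigD1 j)//= [X in _ + lam * X <= _](bigD1 j)//=.
  rewrite [X in _ <= _ + X + _](bigD1 j)//= [X in _ <= _ + lam * X](bigD1 j)//=.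
  rewrite b'j.
  have -> : \sum_(i < p | i != j) gradJ J lam (b1 i 0) * b' i 0 =
            \sum_(i < p | i != j) gradJ J lam (b1 i 0) * b2 i 0.
    by apply: eq_bigr => i ij; rewrite b'i.
  have -> : \sum_(i < p | i != j) `|b' i 0| = \sum_(i < p | i != j) `|b2 i 0|.
    by apply: eq_bigr => i ij; rewrite b'i.
  have -> : `|b2 j 0 - t * s| = `|b2 j 0| - t.
    have sb : s * `|b2 j 0| = b2 j 0 by rewrite /s -numEsg.
    rewrite -{1}sb [t * s]mulrC -mulrBr normrM /s normr_sg bj0 mul1r.
    by rewrite ger0_norm// subr_ge0.
  have -> : (2 * n%:R)^-1 * (t * s * (t * s * N)) = t ^+ 2 / 2.
    rewrite (_ : t * s * _ = t ^+ 2 * N * (s * s)); last by ring.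
    by rewrite ss mulr1 /N; field; rewrite pnatr_eq0 -lt0n.
  have := stage1_grad jA; set w := gradJ _ _ _ => wl.
  have : - (w * (t * s)) <= lam / 4 * t.
    apply: (le_trans (ler_norm _)); rewrite normrN !normrM.
    rewrite /s normr_sg bj0 mulr1 (gtr0_norm t0).
    by rewrite ler_wpM2r// ltW.
  have : t ^+ 2 <= lam * t by rewrite expr2 ler_wpM2r// ltW.
  have : 0 < lam * t by rewrite mulr_gt0 ?lam_gt0.
  lra.
suff -> : b2 = beta by [].
apply/eqP; rewrite -subr_eq0; apply/eqP.
apply: (restricted_eigen_inj n_gt0 g_gt0 RE).
  by move=> j jA; rewrite !mxE b2A// supported_supp// subrr.
by rewrite mulmxBr -yE /y e0 addr0 subrr.
Qed.

End PathOracle.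

(** * Comparison of HBIC values *)

Lemma sqr_le_mul_amgm {R : realFieldType} (x s t : R) :
  0 <= s -> 0 <= t -> x ^+ 2 <= s * t -> 2 * x <= s + t.
Proof.
move=> s0 t0 xst; rewrite leNgt; apply/negP => H.
have st : 0 <= s + t by rewrite addr_ge0.
have : (s + t) ^+ 2 < (2 * x) ^+ 2.
  by rewrite ltrXn2r// ?nnegrE ?(le_trans st) ?ltW.
have := sqr_ge0 (s - t); nra.
Qed.

(** On [0, 1/2], 1 - x >= 1 / (1 + 2 x) >= e^(- 2 x). *)
Lemma ln1B_ge {R : realType} (x : R) : 0 <= x -> x <= 2^-1 ->
  - (2 * x) <= ln (1 - x).
Proof.
move=> x0 x2.
have x1 : 0 < 1 - x by lra.
rewrite -ler_expR lnK ?posrE// expRN.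
have e2 : 1 + 2 * x <= expR (2 * x) by exact: expR_ge1Dx.
have p2 : 0 < 1 + 2 * x by lra.
apply: (@le_trans _ _ (1 + 2 * x)^-1).
  by rewrite lef_pV2// ?posrE ?expR_gt0.
by rewrite -[leLHS]mul1r ler_pdivrMr//; nra.
Qed.

Section Comparison.
Context {R : realType}.
Variables (n p : nat) (X : 'M[R]_(n, p)) (beta : 'cV[R]_p) (e : 'cV[R]_n).
Hypothesis n_gt0 : (0 < n)%N.
Let A0 := supp beta.
Let q : R := #|A0|%:R.
Let y := X *m beta + e.
Let N : R := n%:R.
Let P0 := colproj (subcols A0 X).
Let rss (b : 'cV[R]_p) := dotv (y - X *m b) (y - X *m b).
Variable bo : 'cV[R]_p.
Hypotheses (boA : supported A0 bo) (boE : X *m bo = P0 *m y).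

Variable t : {set 'I_p} -> R.
Hypothesis t_ge0 : forall B, 0 <= t B.
Hypothesis noise_span : forall B a (s : R), supported B a ->
  dotv e (X *m a + s *: (X *m beta)) ^+ 2 <=
  t B * dotv (X *m a + s *: (X *m beta)) (X *m a + s *: (X *m beta)).
Hypothesis noise_span_perp : forall B a, supported B a ->
  dotv e (X *m a - P0 *m (X *m a)) ^+ 2 <=
  t B * dotv (X *m a - P0 *m (X *m a)) (X *m a - P0 *m (X *m a)).

Lemma rss_decomp b : rss b = rss bo - 2 * dotv (y - X *m bo) (X *m (b - bo))
  + dotv (X *m (b - bo)) (X *m (b - bo)).
Proof. by rewrite -dotv_sqrB /rss mulmxBr opprB addrA subrK. Qed.

Lemma rss_oracle_min b : supported A0 b -> rss bo <= rss b.
Proof.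
move=> bA; rewrite (rss_decomp b) oracle_residual_orth//.
  by rewrite mulr0 subr0 lerDl dotv_ge0.
by move=> j jA; rewrite !mxE boA// bA// subrr.
Qed.

(** Only [m], the part of X (b - bo) orthogonal to the true model, correlates with the oracle
    residual, and it comes from the columns outside A0 alone. Then 2 <e, m> <= t + |m|^2. *)
Lemma rss_overfit (A : {set 'I_p}) b : A0 \subset A -> supported A b ->
  rss bo - t (A :\: A0) <= rss b.
Proof.
move=> sA bA; rewrite (rss_decomp b); pose h := b - bo.
pose h0 : 'cV[R]_p := \col_j (if j \in A0 then h j 0 else 0).
pose h1 : 'cV[R]_p := \col_j (if j \in A0 then 0 else h j 0).
have hE : h = h0 + h1.
  by apply/colP => j; rewrite !mxE; case: (j \in A0); rewrite ?addr0 ?add0r.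
have h0A : supported A0 h0 by move=> j /negbTE jA; rewrite mxE jA.
have h1B : supported (A :\: A0) h1.
  move=> j; rewrite !inE mxE negb_and negbK inE; case: ifP => //= _ jA.
  rewrite !mxE bA// boA ?subrr//.
  by apply: contra jA => /(fintype.subsetP sA).
pose m := X *m h1 - P0 *m (X *m h1).
have PP (u : 'cV[R]_n) : P0 *m (P0 *m u) = P0 *m u by rewrite mulmxA colproj_idem.
have Pm : P0 *m m = 0 by rewrite mulmxBr PP subrr.
have Xh : X *m h = P0 *m (X *m h) + m.
  rewrite hE !mulmxDr colproj_supported// /m -addrA; congr (_ + _).
  by rewrite addrC subrK.
have rE : y - X *m bo = e - P0 *m e := oracle_residualE boE.
have rh : dotv (y - X *m bo) (X *m h) = dotv e m.
  rewrite Xh dotvDr rE !dotvBl !dotv_colproj PP subrr add0r.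
  by rewrite Pm dotv0r subr0.
have mh : dotv m m <= dotv (X *m h) (X *m h).
  rewrite Xh [leRHS]dotv_sqrD [dotv (P0 *m _) m]dotv_colproj Pm.
  by rewrite dotv0r mulr0 addr0 lerDr dotv_ge0.
rewrite -/h rh.
have := sqr_le_mul_amgm (t_ge0 _) (dotv_ge0 _) (noise_span_perp h1B).
by rewrite -/m; lra.
Qed.

Let bias (A : {set 'I_p}) := X *m beta - colproj (subcols A X) *m (X *m beta).

(** The residual is e + u, where |u|^2 is at least the squared bias because X b is in the span of
    [A]. Then - 2 <e, u> <= 2 t + |u|^2 / 2 leaves half of the bias. *)
Lemma rss_underfit (A : {set 'I_p}) b : supported A b ->
  dotv e e + dotv (bias A) (bias A) / 2 - 2 * t A <= rss b.
Proof.
move=> bA; set m := bias A; pose u := X *m beta - X *m b.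
have uE : u = X *m (- b) + 1 *: (X *m beta).
  by rewrite scale1r mulmxN addrC.
have yu : y - X *m b = e + u by rewrite /u /y addrA [e + _]addrC.
have bA' : supported A (- b) by move=> j jA; rewrite mxE bA// oppr0.
have := noise_span 1 bA'; rewrite -uE => eu.
have mu : dotv m m <= dotv u u.
  set PA := colproj (subcols A X).
  have mE : m = u - PA *m u.
    by rewrite /m /bias /u mulmxBr (colproj_supported X bA) opprB addrA subrK.
  have PP : PA *m (PA *m u) = PA *m u by rewrite mulmxA colproj_idem.
  have -> : dotv m m = dotv u u - dotv (PA *m u) (PA *m u).
    by rewrite mE dotv_sqrB -dotv_colproj -[in X in _ - 2 * X]PP dotv_colproj; ring.
  by rewrite gerBl dotv_ge0.
rewrite /rss yu dotv_sqrD.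
have h1 : (- dotv e u) ^+ 2 <= (2 * t A) * (dotv u u / 2).
  by rewrite sqrrN; move: eu; lra.
have h2 : 0 <= 2 * t A by rewrite mulr_ge0.
have h3 : 0 <= dotv u u / 2 by rewrite divr_ge0 ?dotv_ge0.
have := sqr_le_mul_amgm h2 h3 h1; move: mu; lra.
Qed.

Lemma rss_oracle_bounds : dotv e e - t A0 <= rss bo <= dotv e e.
Proof.
rewrite /rss (oracle_residualE boE); set u := P0 *m e.
have eu : dotv e u = dotv u u.
  by rewrite /u dotv_colproj mulmxA colproj_idem.
have -> : dotv (e - u) (e - u) = dotv e e - dotv u u by rewrite dotv_sqrB eu; ring.
have u0 := dotv_ge0 u.
rewrite gerBl u0 andbT lerD2l lerN2.
have [a aA uE] := colproj_range X A0 e.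
(* With s = 0 and <e, u> = |u|^2 the hypothesis reads |u|^4 <= t |u|^2. *)
have := noise_span 0 aA; rewrite scale0r addr0 -uE -/u eu expr2.
have [->|un0] := eqVneq (dotv u u) 0; first by rewrite t_ge0.
by rewrite ler_pM2r// lt_def un0.
Qed.

Variables (bhat : R -> 'cV[R]_p) (lam0 lamhat C K L c0 M cT kap : R).
Hypotheses (C_gt0 : 0 < C) (L_gt0 : 0 < L) (c0_gt0 : 0 < c0) (M_gt0 : 0 < M).
Hypotheses (kap_gt0 : 0 < kap) (cT_gt0 : 0 < cT).
Hypothesis LE : ln p%:R = L.
Hypotheses (lam0_gt0 : 0 < lam0) (qK : q < K).
Hypothesis bhat_lam0 : X *m bhat lam0 = P0 *m y /\ supp (bhat lam0) = A0.
Hypothesis tE : forall B, t B = cT * (#|B|.+1%:R * L).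
Hypothesis e_lower : c0 * N <= dotv e e.
Hypothesis e_upper : dotv e e <= M * N.
Hypothesis gap : forall A : {set 'I_p}, ~~ (A0 \subset A) -> #|A|%:R <= K ->
  kap * N <= dotv (bias A) (bias A).
(** The guard matters because [K] may be below 1 when q = 0, and the growth condition bounds K log p
    through K <= K^2. Every competing support satisfying the cardinality bound forces 1 <= K. *)
Hypothesis K_c0 : 1 <= K -> 2 * cT * K * L <= c0 / 4 * N.
Hypothesis K_kap : 1 <= K -> 2 * cT * K * L <= kap / 8 * N.
Hypothesis C_large : 8 * cT < C * c0.
Hypothesis qC_small : q * C * L / N < ln (1 + kap / (4 * M)).

Let N_gt0 : 0 < N. Proof. by rewrite ltr0n. Qed.

Lemma sigma2_hatE z : sigma2_hat X y bhat z = rss (bhat z) / N.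
Proof. by rewrite /sigma2_hat norm2_dotv mulrC. Qed.

Lemma tK (B : {set 'I_p}) : 1 <= K -> #|B|%:R <= K -> t B <= 2 * cT * K * L.
Proof.
move=> K1 BK; rewrite tE -natr1.
have := ler_wpM2l (ltW (mulr_gt0 cT_gt0 L_gt0)) (lerD BK K1).
lra.
Qed.

Lemma rss_ge0 b : 0 <= rss b. Proof. exact: dotv_ge0. Qed.

Lemma rss_lam0 : rss (bhat lam0) = rss bo.
Proof. by rewrite /rss bhat_lam0.1 boE. Qed.

Lemma HBIC_fin z : 0 < rss (bhat z) ->
  HBIC X y bhat C z =
    (ln (rss (bhat z) / N) + #|supp (bhat z)|%:R * (C * L / N))%:E.
Proof. by move=> s0; rewrite /HBIC sigma2_hatE lne_EFin ?divr_gt0// LE. Qed.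

Lemma HBIC_same z : supp (bhat z) = A0 ->
  (HBIC X y bhat C lam0 <= HBIC X y bhat C z)%E.
Proof.
move=> zA; rewrite /HBIC bhat_lam0.2 zA !sigma2_hatE rss_lam0 leeD2r//.
have nneg b : (rss b / N)%:E \in `[0%E, +oo%E].
  by rewrite in_itv/= leey andbT lee_fin divr_ge0 ?rss_ge0 ?ltW.
rewrite (lee_lne (nneg _) (nneg _)) lee_fin.
rewrite ler_pM2r ?invr_gt0//; apply: rss_oracle_min.
by rewrite -zA; exact: supported_supp.
Qed.

Lemma rss_bo_lower : 1 <= K -> c0 / 2 * N <= rss bo.
Proof.
move=> K1; have /andP[+ _] := rss_oracle_bounds.
have := tK (B := A0) K1 (ltW qK); have := K_c0 K1.
have := e_lower; have := mulr_gt0 c0_gt0 N_gt0; lra.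
Qed.

Lemma HBIC_overfit z : #|supp (bhat z)|%:R <= K -> A0 \proper supp (bhat z) ->
  (HBIC X y bhat C lam0 < HBIC X y bhat C z)%E.
Proof.
set A := supp (bhat z) => AK /fintype.properP[sA [j jA jA0]].
set B := A :\: A0.
have B0 : (0 < #|B|)%N.
  by apply/card_gt0P; exists j; rewrite finset.in_setD jA0 jA.
have AE : #|A|%:R = q + #|B|%:R :> R.
  by rewrite -natrD -(cardsID A0 A) (finset.setIidPr sA).
have B1 : 1 <= #|B|%:R :> R by rewrite ler1n.
have q0 : 0 <= q by rewrite ler0n.
have K1 : 1 <= K by move: AK; rewrite AE; lra.
have BK : #|B|%:R <= K by move: AK; rewrite AE; lra.
have lo := rss_bo_lower K1.
have lo0 : 0 < rss bo by rewrite (lt_le_trans _ lo)// !mulr_gt0.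
pose x := t B / rss bo.
have x0 : 0 <= x by rewrite divr_ge0// ltW.
have cN := mulr_gt0 c0_gt0 N_gt0.
have x2 : x <= 2^-1.
  rewrite ler_pdivrMr//; have := tK K1 BK; have := K_c0 K1; lra.
have hi := rss_overfit sA (@supported_supp _ _ (bhat z)).
rewrite -/A -/B in hi.
have hi' : rss bo * (1 - x) <= rss (bhat z).
  rewrite (le_trans _ hi)// mulrBr mulr1 /x mulrCA divff ?mulr1// gt_eqF//.
have x1 : 0 < 1 - x by lra.
have z0 : 0 < rss (bhat z) by rewrite (lt_le_trans _ hi')// mulr_gt0.
rewrite !HBIC_fin ?rss_lam0//.
rewrite lte_fin bhat_lam0.2 -/A -/q AE mulrDl.
have lnz : ln (rss bo / N) - 2 * x <= ln (rss (bhat z) / N).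
  apply: (@le_trans _ _ (ln (rss bo / N) + ln (1 - x))).
    by rewrite lerD2l ln1B_ge.
  rewrite -lnM ?posrE ?divr_gt0// ler_ln ?posrE ?divr_gt0 ?mulr_gt0 ?invr_gt0//.
  by rewrite mulrAC ler_pM2r ?invr_gt0.
suff : 2 * x < #|B|%:R * (C * L / N) by move: lnz; lra.
have xle : x * (c0 * N) <= 4 * cT * (#|B|%:R * L).
  have : x * (c0 / 2 * N) <= t B.
    by rewrite -[leRHS](divfK (lt0r_neq0 lo0)) -/x ler_wpM2l.
  rewrite tE -[#|B|.+1%:R]natr1.
  have := ler_wpM2l (ltW (mulr_gt0 cT_gt0 L_gt0)) B1; lra.
rewrite -(ltr_pM2r cN).
have -> : #|B|%:R * (C * L / N) * (c0 * N) = C * c0 * (#|B|%:R * L).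
  by field; rewrite gt_eqF.
have BL : 0 < #|B|%:R * L by rewrite mulr_gt0// ltr0n.
have : 8 * cT * (#|B|%:R * L) < C * c0 * (#|B|%:R * L) by rewrite ltr_pM2r.
by move: xle; lra.
Qed.

(** The bias raises the residual sum of squares by kap N / 4, a fraction at least kap / (4 M) of the
    oracle value. The gain in the logarithm exceeds the whole penalty of the true model. *)
Lemma HBIC_underfit z : #|supp (bhat z)|%:R <= K -> ~~ (A0 \subset supp (bhat z)) ->
  (HBIC X y bhat C lam0 < HBIC X y bhat C z)%E.
Proof.
set A := supp (bhat z) => AK nA.
have q1 : 1 <= q.
  rewrite ler1n card_gt0; apply: contraNneq nA => ->; exact: finset.sub0set.
have K1 : 1 <= K by rewrite (le_trans q1)// ltW.
have lo := rss_bo_lower K1.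
have lo0 : 0 < rss bo by rewrite (lt_le_trans _ lo)// !mulr_gt0.
have /andP[_ up] := rss_oracle_bounds.
have hi := rss_underfit (@supported_supp _ _ (bhat z)).
have wN := gap nA AK; rewrite -/A in hi.
have hi' : rss bo + kap / 4 * N <= rss (bhat z).
  have := tK K1 AK; have := K_kap K1; move: hi wN up; lra.
have kN : 0 < kap * N by rewrite mulr_gt0.
have z0 : 0 < rss (bhat z) by move: hi'; lra.
rewrite !HBIC_fin ?rss_lam0//.
rewrite lte_fin bhat_lam0.2 -/A -/q.
have pos : 0 <= #|A|%:R * (C * L / N).
  by rewrite !mulr_ge0 ?ler0n ?invr_ge0// ltW.
have k4 : 0 < 1 + kap / (4 * M) by rewrite addr_gt0// divr_gt0// mulr_gt0.
have lnz : ln (rss bo / N) + ln (1 + kap / (4 * M)) <= ln (rss (bhat z) / N).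
  rewrite -lnM ?posrE ?divr_gt0// ler_ln ?posrE ?divr_gt0 ?mulr_gt0 ?invr_gt0//.
  rewrite mulrAC ler_pM2r ?invr_gt0// (le_trans _ hi')// mulrDr mulr1 lerD2l.
  have : rss bo <= M * N by rewrite (le_trans up).
  move=> /(ler_wpM2r (ltW (divr_gt0 kap_gt0 (mulr_gt0 (ltr0Sn R 3) M_gt0)))).
  move=> /le_trans; apply; rewrite le_eqVlt; apply/orP; left; apply/eqP.
  by field; rewrite gt_eqF.
have := qC_small; move: lnz pos.
have -> : q * C * L / N = q * (C * L / N) by rewrite !mulrA.
lra.
Qed.

(** The minimum is attained at [lam0], so [selects_HBIC] does constrain [lamhat], and every other
    support is strictly worse. *)
Lemma selects_HBIC_supp :
  selects_HBIC X y bhat C K lamhat -> supp (bhat lamhat) = A0.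
Proof.
have lam0K : tuning_range bhat K lam0.
  by split=> //; rewrite bhat_lam0.2 ltW.
have better z : tuning_range bhat K z -> supp (bhat z) != A0 ->
    (HBIC X y bhat C lam0 < HBIC X y bhat C z)%E.
  move=> [_ zK] zA; have [sA|] := boolP (A0 \subset supp (bhat z)).
    by apply: HBIC_overfit => //; rewrite finset.properEneq eq_sym zA.
  exact: HBIC_underfit.
case.
  exists lam0; split=> // z zK.
  have [zA|zA] := eqVneq (supp (bhat z)) A0; first exact: HBIC_same.
  by apply: ltW; exact: better.
move=> hatK hat_le; apply/eqP/negPn/negP => hatA.
have := better _ hatK hatA; rewrite ltNge => /negP; apply.
exact: hat_le.
Qed.

End Comparison.

(** * Selection on the good event *)

Section Selection.
Context {R : realType}.
Variables (n p : nat) (X : 'M[R]_(n, p)) (beta : 'cV[R]_p).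

(** Gram-Schmidt applied to the columns in [B] and to X beta, hence |B| + 1 rows, after the map [H]:
    the identity, or the projection orthogonal to the true model. The matrices do not involve the
    errors, so a union bound over [B] is possible. *)
Lemma span_isometry (H : 'M[R]_n) : exists U : forall B : {set 'I_p}, 'M[R]_(#|B| + 1, n),
  forall B, (forall c, norm2 ((U B)^T *m c) <= norm2 c) /\
    forall a s, supported B a ->
      (U B)^T *m U B *m (H *m (X *m a + s *: (X *m beta))) =
      H *m (X *m a + s *: (X *m beta)).
Proof.
suff ex (B : {set 'I_p}) : exists U : 'M[R]_(#|B| + 1, n),
    (forall c, norm2 (U^T *m c) <= norm2 c) /\
    forall a s, supported B a ->
      U^T *m U *m (H *m (X *m a + s *: (X *m beta))) =
      H *m (X *m a + s *: (X *m beta)).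
  by exists (fun B => sval (cid (ex B))) => B; exact: svalP (cid (ex B)).
pose G := H *m row_mx (subcols B X) (X *m beta).
have [U [UU UG]] := Gram_Schmidt G^T; exists U; split.
  by move=> c; exact: partial_isometry_norm2.
move=> a s aB; rewrite trmxK in UG.
have -> : H *m (X *m a + s *: (X *m beta)) = G *m col_mx (subvec B a) (s%:M).
  by rewrite /G -mulmxA mul_row_col mul_mx_scalar (mulmx_supported X aB).
by rewrite mulmxA UG.
Qed.

(** Scaled to unit length, so that a score is a one-dimensional instance of [noise_tail]. *)
Definition score_row (j : 'I_p) : 'rV[R]_n := (Num.sqrt n%:R)^-1 *: (col j X)^T.

Hypothesis n_gt0 : (0 < n)%N.
Hypothesis Xcol : forall j, dotv (col j X) (col j X) = n%:R.

Lemma score_row_norm2 j (c : 'cV[R]_1) : norm2 ((score_row j)^T *m c) <= norm2 c.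
Proof.
have n0 : 0 < n%:R :> R by rewrite ltr0n.
rewrite -(@ler_pXn2r _ 2)// ?nnegrE ?norm2_ge0// !norm2_dotv.
rewrite [c]mx11_scalar mul_mx_scalar.
have -> : (score_row j)^T = (Num.sqrt n%:R)^-1 *: col j X.
  by apply/matrixP => i k; rewrite !mxE.
rewrite dotvZr dotvC dotvZr dotvZr dotvC dotvZr Xcol.
rewrite [X in _ <= X](_ : _ = c 0 0 * c 0 0); last first.
  by rewrite /dotv big_ord1 mxE eqxx.
rewrite le_eqVlt; apply/orP; left; apply/eqP.
suff nE : (Num.sqrt n%:R)^-1 * ((Num.sqrt n%:R)^-1 * n%:R) = 1 :> R.
  by rewrite nE mulr1.
by rewrite mulrA -expr2 exprVn sqr_sqrtr ?mulVf ?ler0n ?gt_eqF.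
Qed.

Lemma score_row_le j (e : 'cV[R]_n) (mu : R) : 0 < mu ->
  norm2 (score_row j *m e) ^+ 2 <= n%:R * mu ^+ 2 / 4 ->
  `|dotv e (col j X)| <= n%:R * mu / 2.
Proof.
move=> mu0; have n0 : 0 < n%:R :> R by rewrite ltr0n.
have -> : norm2 (score_row j *m e) ^+ 2 = dotv e (col j X) ^+ 2 / n%:R.
  rewrite norm2_dotv /dotv big_ord1 -expr2 -/(dotv _ _).
  have -> : (score_row j *m e) 0 0 = (Num.sqrt n%:R)^-1 * dotv (col j X) e.
    by rewrite dotvE -scalemxAl mxE.
  by rewrite dotvC exprMn exprVn sqr_sqrtr ?ler0n// mulrC.
rewrite ler_pdivrMr// => H.
rewrite -(@ler_pXn2r _ 2)// ?nnegrE//; last by rewrite divr_ge0// mulr_ge0// ltW.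
rewrite real_normK ?num_real//; apply: (le_trans H).
by rewrite le_eqVlt; apply/orP; left; apply/eqP; field.
Qed.


Variables (pen J : R -> R -> R) (a b g tau lam C K lamhat : R).
Variables (bh1 bh : R -> 'cV[R]_p) (e : 'cV[R]_n).
Let A0 := supp beta.
Let y := X *m beta + e.
Hypotheses (g_gt0 : 0 < g) (RE : restricted_eigen X A0 g).
Hypotheses (b_gt0 : 0 < b) (reg : penalty_regular pen J a b) (a_gt1 : 1 < a).
Hypotheses (lam_gt0 : 0 < lam) (tau_gt0 : 0 < tau) (tau_le : tau <= 2^-1).
Hypotheses (ratio_b : 12 * (tau * #|A0|%:R / g ^+ 2) <= b).
Hypotheses (ratio_4 : 12 * (tau * #|A0|%:R / g ^+ 2) <= 4^-1).
Hypothesis signal : forall j, j \in A0 -> (a + 2) * lam <= `|beta j 0|.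
Hypothesis path : cccp_path X y J tau bh1 bh.
Hypotheses (C_gt0 : 0 < C) (qK : #|A0|%:R < K).
Hypothesis selects : selects_HBIC X y bh C K lamhat.
Hypothesis small_scores :
  forall j, norm2 (score_row j *m e) ^+ 2 <= n%:R * (tau * lam) ^+ 2 / 4.

Lemma oracle_at_lam : X *m bh lam = colproj (subcols A0 X) *m y /\ supp (bh lam) = A0.
Proof.
have [am1 am2] := path lam_gt0.
apply: (path_oracle n_gt0 g_gt0 RE Xcol b_gt0 reg lam_gt0 tau_gt0 ratio_b ratio_4 _
  am1 am2) => // j.
by apply: score_row_le; [exact: mulr_gt0 | exact: small_scores].
Qed.

Lemma selects_support_nondegenerate (U1 U2 : forall B : {set 'I_p}, 'M[R]_(#|B| + 1, n))
    (L c0 M cT kap : R) :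
  (forall B a s, supported B a ->
      (U1 B)^T *m U1 B *m (X *m a + s *: (X *m beta)) =
      X *m a + s *: (X *m beta)) ->
  (forall B a s, supported B a ->
      (U2 B)^T *m U2 B *m ((1%:M - colproj (subcols A0 X)) *m
        (X *m a + s *: (X *m beta))) =
      (1%:M - colproj (subcols A0 X)) *m (X *m a + s *: (X *m beta))) ->
  0 < L -> 0 < c0 -> 0 < M -> 0 < kap -> 0 < cT -> ln p%:R = L ->
  (forall B, norm2 (U1 B *m e) ^+ 2 <= cT * (#|B|.+1%:R * L)) ->
  (forall B, norm2 (U2 B *m e) ^+ 2 <= cT * (#|B|.+1%:R * L)) ->
  c0 * n%:R <= norm2 e ^+ 2 -> norm2 e ^+ 2 <= M * n%:R ->
  (forall A : {set 'I_p}, ~~ (A0 \subset A) -> #|A|%:R <= K ->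
    kap * n%:R <= norm2 ((1%:M - colproj (subcols A X)) *m
      (subcols A0 X *m subvec A0 beta)) ^+ 2) ->
  (1 <= K -> 2 * cT * K * L <= c0 / 4 * n%:R) ->
  (1 <= K -> 2 * cT * K * L <= kap / 8 * n%:R) ->
  8 * cT < C * c0 -> #|A0|%:R * C * L / n%:R < ln (1 + kap / (4 * M)) ->
  supp (bh lamhat) = A0.
Proof.
move=> U1E U2E L0 c00 M0 kap0 cT0 LE e1 e2 lo hi gap Kc0 Kkap Cl qCs.
have orc := oracle_at_lam.
have t0 (B : {set 'I_p}) : 0 <= cT * (#|B|.+1%:R * L).
  by rewrite !mulr_ge0 ?ler0n// ltW.
have boA : supported A0 (bh lam) by rewrite -orc.2; exact: supported_supp.
(* The path at [lam] is itself the least squares fit on the true support, so it also plays the role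
   of [bo]. *)
apply: (@selects_HBIC_supp _ _ _ X beta e n_gt0 (bh lam) boA orc.1
  (fun B => cT * (#|B|.+1%:R * L)) t0 _ _ bh lam lamhat C K L c0 M cT kap) => //.
- move=> B v s vB; apply: (le_trans (partial_isometry_dotv e (U1E B v s vB))).
  by rewrite ler_wpM2r ?dotv_ge0.
- move=> B v vB.
  have := U2E B v 0 vB; rewrite scale0r addr0 mulmxBl mul1mx => E.
  apply: (le_trans (partial_isometry_dotv e E)).
  by rewrite ler_wpM2r ?dotv_ge0.
- by rewrite -norm2_dotv.
- by rewrite -norm2_dotv.
- move=> A nA AK; have := gap A nA AK.
  rewrite -(mulmx_supported X (@supported_supp _ _ beta)) mulmxBl mul1mx.
  by rewrite norm2_dotv.
Qed.

(** The exact fit at [lam] gives HBIC the value [-oo], hence a minimum; the selected parameter must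
    reach [-oo] too, that is, fit exactly. *)
Lemma selects_support_noiseless : e = 0 -> supp (bh lamhat) = A0.
Proof.
move=> e0; have [orc suppE] := oracle_at_lam.
have yE : y = X *m bh lam.
  by rewrite orc /y e0 addr0 colproj_supported//; exact: supported_supp.
have lamK : tuning_range bh K lam by split=> //; rewrite suppE ltW.
have HBICNy : HBIC X y bh C lam = -oo%E.
  by rewrite /HBIC /sigma2_hat -yE subrr norm2_dotv dotv0r mulr0 le0_lneNy.
case: selects; first by exists lam; split=> // z _; rewrite HBICNy leNye.
move=> [lamhat0 _] /(_ lam lamK); rewrite HBICNy leeNy_eq => /eqP hatNy.
have yhat : y = X *m bh lamhat.
  apply/eqP; rewrite -subr_eq0; apply/eqP/dotv_eq0/eqP.
  rewrite eq_le dotv_ge0 andbT leNgt; apply/negP => pos.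
  move: hatNy; rewrite /HBIC /sigma2_hat norm2_dotv lne_EFin//.
  by rewrite mulr_gt0// invr_gt0 ltr0n.
have [am1 am2] := path lamhat0.
apply: (zero_noise_supp n_gt0 g_gt0 RE Xcol b_gt0 reg lamhat0 tau_gt0 ratio_b ratio_4 _
  am1 am2) => // j.
rewrite e0 dotvC dotv0r normr0 divr_ge0// mulr_ge0// mulr_ge0// ltW//.
Qed.

End Selection.

(** * Asymptotics *)

(** Expansion of the product of 1 + x over [I], a term for each subset. *)
Lemma sum_set_expr {R : comNzRingType} (I : finType) (x : R) :
  \sum_(B : {set I}) x ^+ #|B| = (1 + x) ^+ #|I|.
Proof.
rewrite addrC -prodr_const bigA_distr.
apply: eq_big => B; first by rewrite inE.
by move=> _; rewrite -prodr_const big_mkcond.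
Qed.

Section Bounds.
Context {R : realType}.

(** Eventually log p <= D / (2 v), so half of the exponent absorbs the factor p; the rest is at most
    2 v chi / D by e^x >= x. *)
Lemma cvg_score_bound (p : nat -> nat) (D : nat -> R) (v : R) (chi : R) :
  0 < v -> 0 <= chi -> D @ \oo --> +oo ->
  (fun n => ln (p n)%:R : R^o) =o_\oo (fun n => D n : R^o) ->
  (p n)%:R * (expR (- (D n / v)) * chi) @[n --> \oo] --> (0 : R).
Proof.
move=> v0 chi0 Dy /eqoP lo.
have v2 : 0 < (2 * v)^-1 by rewrite invr_gt0 mulr_gt0.
apply/cvgrPdist_le => eps eps0; near=> n.
have D0 : 0 < D n by near: n; exact: (cvgry_gt Dy).
have De : 2 * v * chi / eps <= D n by near: n; exact: (cvgry_ge Dy).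
rewrite sub0r normrN ger0_norm ?mulr_ge0 ?ler0n ?expR_ge0//.
have [->|p0] := posnP (p n); first by rewrite mul0r ltW.
have pE : (p n)%:R = expR (ln (p n)%:R) :> R by rewrite lnK// posrE ltr0n.
rewrite pE mulrA -expRD.
have : `|ln (p n)%:R| <= (2 * v)^-1 * `|D n| by near: n; exact: (lo _ v2).
rewrite (gtr0_norm D0) => /(le_trans (ler_norm _)) H.
have {}H : ln (p n)%:R - D n / v <= - (D n / (2 * v)).
  have -> : D n / v = 2 * (D n / (2 * v)) by field; rewrite gt_eqF.
  by move: H; rewrite mulrC; lra.
apply: (@le_trans _ _ (expR (- (D n / (2 * v))) * chi)).
  by rewrite ler_wpM2r// ler_expR.
rewrite expRN mulrC ler_pdivrMr ?expR_gt0// mulrC.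
have : D n / (2 * v) <= expR (D n / (2 * v)).
  by apply: le_trans (expR_ge1Dx _); lra.
move=> /(ler_wpM2l (ltW eps0)); rewrite [eps * expR _]mulrC; apply: le_trans.
move: De; rewrite ler_pdivrMr// => De.
by rewrite mulrA ler_pdivlMr ?mulr_gt0//; move: De; lra.
Unshelve. all: by end_near. Qed.

(** Each term is x^(|B| + 1) with x = chi / p^3, so the sum is x (1 + x)^p <= e x because p x <= 1.
    The factor 3 in the exponent is what beats the number of supports. *)
Lemma sum_set_tail_le (p : nat) (chi : R) : 1 <= chi -> chi <= p%:R ->
  \sum_(B : {set 'I_p}) expR (- (3 * (#|B|.+1%:R * ln p%:R))) * chi ^+ (#|B| + 1)
    <= expR 1 * chi / p%:R.
Proof.
move=> chi1 chip.
have p0 : 0 < p%:R :> R by lra.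
have p1 : 1 <= p%:R :> R by lra.
pose x := chi * (p%:R ^+ 3)^-1.
have x0 : 0 <= x by rewrite mulr_ge0 ?invr_ge0 ?exprn_ge0 ?ltW//; lra.
have -> : \sum_(B : {set 'I_p}) expR (- (3 * (#|B|.+1%:R * ln p%:R))) * chi ^+ (#|B| + 1)
    = x * (1 + x) ^+ p.
  rewrite -[X in (1 + x) ^+ X](card_ord p) -sum_set_expr mulr_sumr.
  apply: eq_bigr => B _; rewrite -exprS addn1 exprMn mulrC; congr (_ * _).
  rewrite expRN exprVn -exprM; congr (_^-1).
  by rewrite mulrA -natrM expRM_natl lnK// posrE.
have xp : p%:R * x <= 1.
  rewrite /x mulrA ler_pdivrMr ?exprn_gt0// mul1r exprS ler_pM2l//.
  by rewrite (le_trans chip)// -[leLHS]expr1 ler_weXn2l.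
have x2 : x <= chi / p%:R.
  rewrite /x ler_wpM2l ?lef_pV2 ?posrE ?exprn_gt0//; first by lra.
  by rewrite -[leLHS]expr1 ler_weXn2l.
have : (1 + x) ^+ p <= expR 1.
  apply: (@le_trans _ _ (expR x ^+ p)).
    by rewrite lerXn2r ?nnegrE ?expR_ge0 ?addr_ge0 ?expR_ge1Dx.
  by rewrite -expRM_natl ler_expR.
move=> H; rewrite mulrC -mulrA ler_pM// exprn_ge0// addr_ge0//.
Qed.

Lemma cvg_set_bound (p : nat -> nat) (chi : R) : 1 <= chi -> p @ \oo --> \oo ->
  (\sum_(B : {set 'I_(p n)})
    expR (- (3 * (#|B|.+1%:R * ln (p n)%:R))) * chi ^+ (#|B| + 1)) @[n --> \oo]
  --> (0 : R).
Proof.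
move=> chi1 py.
have pbig (A : R) : \forall n \near \oo, A <= (p n)%:R.
  exact: (cvgry_ge ((cvgrnyP _).2 py)).
apply/cvgrPdist_le => eps eps0; near=> n.
have p1 : chi <= (p n)%:R by near: n; exact: pbig.
have p2 : expR 1 * chi / eps <= (p n)%:R by near: n; exact: pbig.
have chi0 : 0 <= chi by lra.
rewrite sub0r normrN ger0_norm; last first.
  by apply: sumr_ge0 => B _; rewrite mulr_ge0 ?expR_ge0 ?exprn_ge0.
apply: (le_trans (sum_set_tail_le chi1 p1)).
have p0 : 0 < (p n)%:R :> R by lra.
by move: p2; rewrite ler_pdivrMr// => p2; rewrite ler_pdivrMr//; lra.
Unshelve. all: by end_near. Qed.

End Bounds.

(** * Inner probabilities and extended real limits *)

Lemma inner_prob_ge d (Omega : measurableType d) (R : realType)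
    (P : probability Omega R) (bad E : set Omega) (s : R) :
  measurable bad -> (P bad <= s%:E)%E -> ~` bad `<=` E ->
  ((1 - s)%:E <= inner_prob P E)%E.
Proof.
move=> mb bs bE; apply: (@le_trans _ _ (P (~` bad))).
  by rewrite probability_setC// EFinB leeB.
apply: ereal_sup_ubound; exists (~` bad) => //; split=> //.
exact: measurableC.
Qed.

Lemma inner_prob_le1 d (Omega : measurableType d) (R : realType)
    (P : probability Omega R) (E : set Omega) : (inner_prob P E <= 1)%E.
Proof.
by apply: ge_ereal_sup => _ [F [mF _] <-]; exact: probability_le1.
Qed.

Lemma near_lte_cvg0 (R : realType) (f : nat -> \bar R) (c : R) :
  f @ \oo --> 0%E -> 0 < c -> \forall n \near \oo, (f n < c%:E)%E.
Proof.
move=> /fine_cvgP[ffin fcvg] c0; near=> n.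
have fn : f n \is a fin_num by near: n; exact: ffin.
rewrite -(fineK fn) lte_fin; near: n.
exact: (cvgr_lt _ fcvg).
Unshelve. all: by end_near. Qed.

(** The limit may be [+oo], as for the gap when the true support is empty, so the finite and
    infinite cases are separated. *)
Lemma near_lee_lim (R : realType) (f : nat -> \bar R) (c c' : R) :
  cvgn f -> (c%:E <= limn f)%E -> c' < c -> \forall n \near \oo, (c'%:E <= f n)%E.
Proof.
move=> /cvg_ex[l fl]; rewrite (cvg_lim _ fl)// => cl cc'.
case: l fl cl => [r| |]// fl cl.
  move/fine_cvgP: fl => [ffin fcvg]; near=> n.
  have fn : f n \is a fin_num by near: n; exact: ffin.
  rewrite -(fineK fn) lee_fin; near: n.
  apply: (cvgr_ge _ fcvg); rewrite lee_fin in cl; exact: lt_le_trans cl.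
by move/cvgeyPge: fl => /(_ c').
Unshelve. all: by end_near. Qed.

Lemma signal_lower (R : realType) (p : nat) (beta : 'cV[R]_p) (lam c : R) :
  0 < lam -> 0 < c -> (lam%:E / min_signal beta < (c^-1)%:E)%E ->
  forall j, j \in supp beta -> c * lam <= `|beta j 0|.
Proof.
move=> lam0 c0 H j; rewrite inE => bj0.
have sj : (min_signal beta <= `|beta j 0|%:E)%E.
  by apply: ereal_inf_lbound; exists j.
have s0 : (0 <= min_signal beta)%E.
  by apply: le_ereal_inf_tmp => _ [i _ <-]; rewrite lee_fin.
case: (min_signal beta) sj s0 H => [r| |]//; rewrite lee_fin => rj; rewrite lee_fin => r0.
(* The inverse of 0 in [\bar R] is [+oo], so [H] excludes an infimum equal to 0. *)
rewrite inver; have [_|rn0] := eqVneq r 0; first by rewrite gt0_muley ?lte_fin.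
have {rn0}r0 : 0 < r by rewrite lt_def rn0.
rewrite -EFinM lte_fin ltr_pdivrMr// ltr_pdivlMl// => H.
exact: le_trans (ltW H) rj.
Qed.

Lemma underfit_gap_le (R : realType) (n p : nat) (X : 'M[R]_(n, p)) (beta : 'cV[R]_p)
    (K c : R) (A : {set 'I_p}) : (0 < n)%N ->
  (c%:E <= underfit_gap X beta K)%E -> ~~ (supp beta \subset A) -> #|A|%:R <= K ->
  c * n%:R <= norm2 ((1%:M - colproj (subcols A X)) *m
      (subcols (supp beta) X *m subvec (supp beta) beta)) ^+ 2.
Proof.
move=> n0 /le_trans H nA AK; rewrite -ler_pdivlMr ?ltr0n// mulrC -lee_fin.
by apply: H; apply: ereal_inf_lbound; exists A.
Qed.

Section Limits.
Context {R : realType}.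

Lemma normalized_dotv (n p : nat) (X : 'M[R]_(n, p)) : (0 < n)%N ->
  normalized_columns X -> forall j, dotv (col j X) (col j X) = n%:R.
Proof.
move=> n0 Xn j; have := Xn j; rewrite -dotvE.
by move=> /(congr1 ( *%R^~ n%:R)); rewrite mulfVK ?mul1r// pnatr_eq0 -lt0n.
Qed.

Lemma cvg_inner_prob1 d (Omega : measurableType d) (P : probability Omega R)
    (E : nat -> set Omega) (s : nat -> R) :
  s @ \oo --> 0 -> (\forall n \near \oo, ((1 - s n)%:E <= inner_prob P (E n))%E) ->
  inner_prob P (E n) @[n --> \oo] --> 1%E.
Proof.
move=> s0 H; apply: (@squeeze_cvge _ _ _ _ (fun n => (1 - s n)%:E) _ (fun=> 1%E)).
- near=> n; rewrite inner_prob_le1 andbT; near: n; exact: H.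
- apply: cvg_EFin; first exact: nearW.
  by rewrite -[X in _ --> X]subr0; apply: cvgB => //; exact: cvg_cst.
- exact: cvg_cst.
Unshelve. all: by end_near. Qed.

(** Eventually ln n >= 1, and K <= K^2 under the guard. *)
Lemma near_Klog_le (p : nat -> nat) (K : nat -> R) (c : R) : 0 < c ->
  (fun n => K n ^+ 2 * ln (p n)%:R * ln n%:R : R^o) =o_\oo (fun n => n%:R : R^o) ->
  (\forall n \near \oo, 1 <= K n -> K n * ln (p n)%:R <= c * n%:R).
Proof.
move=> c0 /eqoP/(_ c c0) H; near=> n => K1.
have : `|K n ^+ 2 * ln (p n)%:R * ln n%:R| <= c * `|n%:R| by near: n; exact: H.
rewrite [`|n%:R|]ger0_norm ?ler0n//; apply: le_trans.
apply: le_trans (ler_norm _).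
have n1 : 1 <= ln n%:R :> R.
  have nb : expR 1 <= n%:R :> R by near: n; exact: nbhs_infty_ger.
  by rewrite -ler_expR lnK// posrE (lt_le_trans _ nb)// expR_gt0.
have L0 : 0 <= ln (p n)%:R :> R.
  have [->|] := posnP (p n); first by rewrite ln0.
  by move=> pn; apply: ln_ge0; rewrite ler1n.
rewrite -[leLHS]mulr1; apply: ler_pM => //.
  by rewrite mulr_ge0// (le_trans _ K1).
rewrite expr2 -mulrA ler_peMl// mulr_ge0// (le_trans _ K1)//.
Unshelve. all: by end_near. Qed.

End Limits.

(** * The good event for the errors *)

Section GoodNoise.
Context {d : measure_display} {Omega : measurableType d} {R : realType}.
Variable P : probability Omega R.
Variables (n p : nat) (X : 'M[R]_(n, p)) (Z : 'I_n -> {RV P >-> R}) (sigma rho : R).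
Hypotheses (n_gt0 : (0 < n)%N) (sigma_gt0 : 0 < sigma).
Hypothesis Xcol : forall j, dotv (col j X) (col j X) = n%:R.
Hypothesis indep : mutually_independent Z.
Hypothesis subg : forall i t,
  (mmt_gen_fun P (Z i) t <= (expR (sigma ^+ 2 * t ^+ 2 / 2))%:E)%E.
Hypotheses (rho_gt0 : 0 < rho) (rho_lt1 : rho < 1).
Hypothesis rhoE : forall i, (\int[P]_x (expR (- Z i x ^+ 2))%:E <= rho%:E)%E.
Variables U1 U2 : forall B : {set 'I_p}, 'M[R]_(#|B| + 1, n).
Hypothesis U1_norm : forall B c, norm2 ((U1 B)^T *m c) <= norm2 c.
Hypothesis U2_norm : forall B c, norm2 ((U2 B)^T *m c) <= norm2 c.
Variables (D L : R).

Let chi : R := chi2_cst.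
Let t (B : {set 'I_p}) : R := 12 * sigma ^+ 2 * (#|B|.+1%:R * L).
Let setsum : R := \sum_(B : {set 'I_p})
  expR (- (3 * (#|B|.+1%:R * L))) * chi ^+ (#|B| + 1).

(** A union of five bad events. Dividing by 4 sigma^2, the level [t B] yields the exponent 3 (|B| +
    1) L of [sum_set_tail_le]; the upper level for |eps|^2 cancels chi^n and leaves e^(-n); the
    lower level uses half of - ln rho, leaving rho^(n/2). *)
Lemma good_noise_event : exists bad : set Omega,
  [/\ measurable bad,
   (P bad <= (p%:R * (expR (- (D / (16 * sigma ^+ 2))) * chi) + setsum + setsum +
     expR (- n%:R) + expR (ln rho / 2) ^+ n)%:E)%E &
   forall w, ~ bad w ->
     [/\ forall j, norm2 (score_row X j *m noise Z w) ^+ 2 <= D / 4,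
      forall B, norm2 (U1 B *m noise Z w) ^+ 2 <= t B,
      forall B, norm2 (U2 B *m noise Z w) ^+ 2 <= t B,
      - (ln rho / 2) * n%:R <= norm2 (noise Z w) ^+ 2 &
      norm2 (noise Z w) ^+ 2 <= 4 * sigma ^+ 2 * (ln chi + 1) * n%:R]].
Proof.
have s1 : sigma != 0 by rewrite gt_eqF.
have chi0 : 0 < chi := chi2_cst_gt0.
have [m1 P1] := noise_family_tail sigma_gt0 indep subg (U := score_row X)
  (fun=> D / 4) (fun j => score_row_norm2 n_gt0 Xcol j).
have [m2 P2] := noise_family_tail sigma_gt0 indep subg t U1_norm.
have [m3 P3] := noise_family_tail sigma_gt0 indep subg t U2_norm.
have m4 := measurable_noise_gt Z 1%:M (4 * sigma ^+ 2 * (ln chi + 1) * n%:R).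
have P4 := noise_tail sigma_gt0 indep subg (U := 1%:M)
  (4 * sigma ^+ 2 * (ln chi + 1) * n%:R).
have m5 := measurable_noise_lt Z (- (ln rho / 2) * n%:R).
have P5 := @noise_lower_tail _ _ _ P n Z indep rho (- (ln rho / 2)) (ltW rho_gt0) rhoE.
set b1 := [set x | _] in m1 P1; set b2 := [set x | _] in m2 P2.
set b3 := [set x | _] in m3 P3; set b4 := [set x | _] in m4 P4.
set b5 := [set x | _] in m5 P5.
exists (b1 `|` b2 `|` b3 `|` b4 `|` b5); split.
- by do !apply: measurableU.
- rewrite !EFinD.
  have m12 : measurable (b1 `|` b2) by exact: measurableU.
  have m123 : measurable (b1 `|` b2 `|` b3) by exact: measurableU.
  have m1234 : measurable (b1 `|` b2 `|` b3 `|` b4) by exact: measurableU.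
  apply: (le_trans (measureU2 _ m1234 m5)); apply: leeD; last first.
    apply: (le_trans P5); rewrite lee_fin.
    rewrite -[X in _ * X](lnK (_ : rho \in Num.pos))// -expRD.
    by rewrite (_ : _ + _ = ln rho / 2)//; field.
  apply: (le_trans (measureU2 _ m123 m4)); apply: leeD; last first.
    apply: (le_trans (P4 _)); first by move=> c; rewrite trmx1 mul1mx.
    have -> : chi2_cst ^+ n = expR (n%:R * ln chi) :> R.
      by rewrite expRM_natl lnK// posrE.
    rewrite lee_fin -expRD.
    by rewrite ler_expR le_eqVlt; apply/orP; left; apply/eqP; field.
  apply: (le_trans (measureU2 _ m12 m3)); apply: leeD; last first.
    apply: (le_trans P3); rewrite lee_fin; apply: ler_sum => B _.
    rewrite le_eqVlt; apply/orP; left; apply/eqP; congr (expR _ * _).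
    by rewrite /t; field.
  apply: (le_trans (measureU2 _ m1 m2)); apply: leeD; last first.
    apply: (le_trans P2); rewrite lee_fin; apply: ler_sum => B _.
    rewrite le_eqVlt; apply/orP; left; apply/eqP; congr (expR _ * _).
    by rewrite /t; field.
  apply: (le_trans P1); rewrite lee_fin sumr_const card_ord [leRHS]mulr_natl.
  rewrite le_eqVlt; apply/orP; left; apply/eqP; congr (expR _ * _ *+ _).
  by field.
move=> w Hw.
split.
- move=> j; rewrite leNgt; apply/negP => H; apply: Hw.
  by do 4!left; exists j.
- move=> B; rewrite leNgt; apply/negP => H; apply: Hw.
  by do 3!left; right; exists B.
- move=> B; rewrite leNgt; apply/negP => H; apply: Hw.
  by do 2!left; right; exists B.
- by rewrite leNgt; apply/negP => H; apply: Hw; right.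
- by rewrite leNgt; apply/negP => H; apply: Hw; left; right; rewrite /b4/= mul1mx.
Qed.

End GoodNoise.

(** * Selection consistency *)

Theorem theorem3p5
  (R : realType) (d : measure_display) (Omega : measurableType d)
  (P : probability Omega R)
  (* linear model *)
  (p : nat -> nat) (X : forall n : nat, 'M[R]_(n, p n))
  (beta : forall n : nat, 'cV[R]_(p n))
  (eps : forall n : nat, 'I_n -> {RV P >-> R})
  (* penalty *)
  (pen J : R -> R -> R)
  (* constants *)
  (C1 sigma a0 a b kappa : R)
  (* sequences of tuning quantities *)
  (tau lam C K : nat -> R)
  (* calibrated path and HBIC selection *)
  (bhat1 bhat : forall n : nat, Omega -> R -> 'cV[R]_(p n))
  (lamhat : nat -> Omega -> R) :
  let A0 := fun n : nat => supp (beta n) in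
  let q := fun n : nat => #|A0 n| in
  let y := fun n : nat => response (X n) (beta n) (eps n) in
  let gamma := fun n : nat => RE_const (X n) (beta n) in
  (forall n : nat, (0 < n)%N -> normalized_columns (X n)) ->
  0 < a0 -> penalty_standardized pen a0 ->
  (forall n : nat, (0 < n)%N -> 0 < tau n) ->
  (forall n : nat, (0 < n)%N -> 0 < lam n) ->
  (forall n : nat, (0 < n)%N -> 0 < C n) ->
  (forall n : nat, (0 < n)%N -> (q n)%:R < K n) ->
  (* (A1) *)
  0 < C1 ->
  (forall n : nat, (0 < n)%N ->
    (C1%:E <= lambda_min (n%:R^-1 *: ((subcols (A0 n) (X n))^T *m
                                        subcols (A0 n) (X n))))%E) ->
  (* (A2) *)
  0 < sigma -> subgaussian_errors sigma eps ->
  (* (A3) *)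
  1 < a -> 0 < b -> b <= a -> penalty_regular pen J a b ->
  (* (A4) *)
  (forall n : nat, (0 < n)%N -> (0 < gamma n)%E) ->
  (* (A5) *)
  ((lam n)%:E / min_signal (beta n))%E @[n --> \oo] --> 0%E ->
  tau @ \oo --> (0 : R) ->
  (* growth conditions on tau and lam *)
  (n%:R * tau n ^+ 2 * lam n ^+ 2) @[n --> \oo] --> +oo ->
  (fun n => ln (p n)%:R : R^o) =o_\oo
    (fun n => n%:R * tau n ^+ 2 * lam n ^+ 2 : R^o) ->
  ((tau n)%:E * (gamma n)^-1 ^+ 2 * (q n)%:R%:E)%E @[n --> \oo]
    --> 0%E ->
  (* identifiability of the true model *)
  0 < kappa ->
  cvgn (fun n => underfit_gap (X n) (beta n) (K n)) ->
  (kappa%:E <= limn (fun n => underfit_gap (X n) (beta n) (K n)))%E ->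
  (* growth conditions on C, K, p and q *)
  C @ \oo --> +oo ->
  (fun n => (q n)%:R * C n * ln (p n)%:R : R^o) =o_\oo (fun n => n%:R : R^o) ->
  (fun n => K n ^+ 2 * ln (p n)%:R * ln n%:R : R^o) =o_\oo
    (fun n => n%:R : R^o) ->
  p @ \oo --> \oo ->
  (* estimators *)
  (forall (n : nat) w, (0 < n)%N ->
    cccp_path (X n) (y n w) J (tau n) (bhat1 n w) (bhat n w)) ->
  (forall (n : nat) w, (0 < n)%N ->
    selects_HBIC (X n) (y n w) (bhat n w) (C n) (K n) (lamhat n w)) ->
  inner_prob P [set w | supp (bhat n w (lamhat n w)) = A0 n] @[n --> \oo]
    --> 1%E.
Proof.
move=> A0 q y gamma Xnorm _ _ tau_gt0 lam_gt0 C_gt0 qK _ _ sigma_gt0 sub.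
move=> a_gt1 b_gt0 _ reg gamma_gt0 signal tau0 Dy logp ratio kappa_gt0 gap_cvg gap_lim.
move=> Cy qC Klog py path sel.
have [indep ident _ subg] := sub.
pose Z1 : {RV P >-> R} := eps 1%N ord0.
have [rho [rho0 rho1 rhoE]] := integral_expR_oppsqr_le1 Z1.
have rho_all n (i : 'I_n) : (\int[P]_x (expR (- eps n i x ^+ 2))%:E = rho%:E)%E.
  by rewrite -rhoE; apply: integral_expR_oppsqr => B mB; exact: ident.
(* With 12 eta = min(b, 1/4), the first-step error stays below both b lam and lam / 4. *)
pose eta : R := Num.min b 4^-1 / 12.
have eta_gt0 : 0 < eta by rewrite divr_gt0// lt_min b_gt0 invr_gt0 ltr0n.
have near_tau : \forall n \near \oo, tau n <= 2^-1.
  by apply: (cvgr_le _ tau0).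
have near_ratio := near_lte_cvg0 ratio eta_gt0.
have a2_gt0 : 0 < a + 2 by lra.
have a2V_gt0 : 0 < (a + 2)^-1 by rewrite invr_gt0.
have near_signal := near_lte_cvg0 signal a2V_gt0.
have near_RE : \forall n \near \oo, exists g, [/\ 0 < g,
    restricted_eigen (X n) (A0 n) g,
    12 * (tau n * #|A0 n|%:R / g ^+ 2) <= b &
    12 * (tau n * #|A0 n|%:R / g ^+ 2) <= 4^-1].
  near=> n.
  have n0 : (0 < n)%N by near: n; exact: nbhs_infty_gt.
  have rn : ((tau n)%:E * (gamma n)^-1 ^+ 2 * (q n)%:R%:E < eta%:E)%E.
    by near: n; exact: near_ratio.
  have [g [g0 RE gq]] :=
    RE_const_restricted_eigen n0 eta_gt0 (gamma_gt0 n n0) rn.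
  exists g; split=> //.
    apply: (@le_trans _ _ (12 * eta)); first by rewrite ler_pM2l// ltW.
    by rewrite /eta mulrC divfK// ge_min lexx.
  apply: (@le_trans _ _ (12 * eta)); first by rewrite ler_pM2l// ltW.
  by rewrite /eta mulrC divfK// ge_min lexx orbT.
have near_sig : \forall n \near \oo, forall j, j \in A0 n ->
    (a + 2) * lam n <= `|beta n j 0|.
  near=> n; apply: signal_lower => //; last by near: n; exact: near_signal.
  by apply: lam_gt0; near: n; exact: nbhs_infty_gt.
(* All errors share one law, so [rho] does not depend on n: either they vanish almost surely for
   every n, or rho < 1. *)
have [rho_lt1|rho_ge1] := ltP rho 1; last first.
  have rho_eq1 : rho = 1 by apply/le_anti; rewrite rho1.
  apply: (@cvg_inner_prob1 _ _ _ _ _ (fun=> 0)); first exact: cvg_cst.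
  near=> n.
  have n0 : (0 < n)%N by near: n; exact: nbhs_infty_gt.
  have [g [g0 RE rb r4]] : exists g, [/\ 0 < g,
      restricted_eigen (X n) (A0 n) g,
      12 * (tau n * #|A0 n|%:R / g ^+ 2) <= b &
      12 * (tau n * #|A0 n|%:R / g ^+ 2) <= 4^-1] by near: n; exact: near_RE.
  have P0 i : (P [set w | eps n i w != 0%R] <= (0 : R)%:E)%E.
    by rewrite ae_eq0_integral_expR// rho_all rho_eq1.
  have [mbad Pbad] := @finite_union_bound _ _ _ P 'I_n
    (fun i => [set w | eps n i w != 0]) (fun=> 0)
    (fun i => measurable_RV_neq0 (eps n i))
    P0.
  apply: (inner_prob_ge mbad); first by rewrite big1 in Pbad.
  move=> w /= nbad.
  have e0 : \col_i eps n i w = 0.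
    apply/colP => i; rewrite !mxE; apply/eqP/negPn/negP => ei.
    by apply: nbad; exists i.
  apply: (selects_support_noiseless n0 (normalized_dotv n0 (Xnorm n n0)) g0 RE
    b_gt0 reg a_gt1 (lam_gt0 n n0) (tau_gt0 n n0) _ rb r4 _ (path n w n0)
    (qK n n0) (sel n w n0) _ e0).
  - by near: n; exact: near_tau.
  - by near: n; exact: near_sig.
  - by move=> j; rewrite e0 mulmx0 norm2_dotv dotv0r divr_ge0// mulr_ge0// sqr_ge0.
pose chi : R := chi2_cst.
have chi_gt0 : 0 < chi := chi2_cst_gt0.
(* Only 0 <= rho has been established, and ln 0 = 0 would make c0 vanish; the maximum is positive
   and still below 1. *)
pose rho' := Num.max rho 2^-1.
have rho'_gt0 : 0 < rho' by rewrite lt_max invr_gt0 ltr0n orbT.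
have rho'_lt1 : rho' < 1 by rewrite gt_max rho_lt1/= invf_lt1// ltr1n.
have rho'E n (i : 'I_n) : (\int[P]_x (expR (- eps n i x ^+ 2))%:E <= rho'%:E)%E.
  by rewrite rho_all lee_fin le_max lexx.
pose c0 := - (ln rho' / 2).
have c0_gt0 : 0 < c0.
  have : ln rho' < 0 by rewrite ln_lt0// rho'_gt0.
  by rewrite /c0; lra.
pose M := 4 * sigma ^+ 2 * (ln chi + 1).
pose cT := 12 * sigma ^+ 2.
have s2_gt0 : 0 < sigma ^+ 2 by rewrite exprn_gt0.
have M_gt0 : 0 < M.
  by rewrite !mulr_gt0// ltr_wpDl// ln_ge0// chi2_cst_ge1.
have cT_gt0 : 0 < cT by rewrite mulr_gt0.
(* The gap reaches [kappa] only in the limit; half of it holds for all large n. *)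
pose kap := kappa / 2.
have kap_gt0 : 0 < kap by rewrite divr_gt0.
pose D n : R := n%:R * tau n ^+ 2 * lam n ^+ 2.
pose L n : R := ln (p n)%:R.
pose S n : R := \sum_(B : {set 'I_(p n)})
  expR (- (3 * (#|B|.+1%:R * L n))) * chi ^+ (#|B| + 1).
apply: (@cvg_inner_prob1 _ _ _ _ _ (fun n =>
  (p n)%:R * (expR (- (D n / (16 * sigma ^+ 2))) * chi) + S n + S n +
  expR (- n%:R) + expR (ln rho' / 2) ^+ n)).
  have -> : 0 = 0 + 0 + 0 + 0 + 0 :> R by rewrite !addr0.
  apply: cvgD; last first.
    by apply: cvg_expr; rewrite ger0_norm ?expR_ge0// expR_lt1 -oppr_gt0.
  apply: cvgD; last exact: cvgn_expR.
  apply: cvgD; last exact: (cvg_set_bound chi2_cst_ge1 py).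
  apply: cvgD; last exact: (cvg_set_bound chi2_cst_ge1 py).
  by apply: cvg_score_bound => //; [rewrite mulr_gt0 | exact: ltW].
have near_K (c : R) : 0 < c ->
    \forall n \near \oo, 1 <= K n -> 2 * cT * K n * L n <= c * n%:R.
  move=> c_gt0; have cc : 0 < c / (2 * cT) by rewrite divr_gt0// mulr_gt0.
  near=> n => K1.
  have : 1 <= K n -> K n * L n <= c / (2 * cT) * n%:R.
    by near: n; exact: (near_Klog_le cc Klog).
  have cT2 : 0 < 2 * cT by rewrite mulr_gt0.
  move=> /(_ K1)/(ler_wpM2l (ltW cT2)).
  by rewrite mulrA [X in _ <= X]mulrA [2 * cT * (c / _)]mulrC divfK ?gt_eqF.
have near_K1 := near_K _ (divr_gt0 c0_gt0 (ltr0Sn R 3)).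
have near_K2 := near_K _ (divr_gt0 kap_gt0 (ltr0Sn R 7)).
have near_C : \forall n \near \oo, 8 * cT / c0 < C n by exact: (cvgry_gt Cy).
pose omega := ln (1 + kap / (4 * M)).
have omega_gt0 : 0 < omega.
  by rewrite ln_gt0// ltrDl divr_gt0// mulr_gt0.
have near_qC : \forall n \near \oo,
    `|(q n)%:R * C n * L n| <= omega / 2 * `|n%:R|.
  by move/eqoP: qC; apply; rewrite divr_gt0.
have near_gap : \forall n \near \oo,
    (kap%:E <= underfit_gap (X n) (beta n) (K n))%E.
  apply: (near_lee_lim gap_cvg gap_lim).
  by rewrite /kap; lra.
have near_p : \forall n \near \oo, 2 <= (p n)%:R :> R.
  exact: (cvgry_ge ((cvgrnyP _).2 py)).
near=> n.
have n0 : (0 < n)%N by near: n; exact: nbhs_infty_gt.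
have nR0 : 0 < n%:R :> R by rewrite ltr0n.
have [g [g0 RE rb r4]] : exists g, [/\ 0 < g,
    restricted_eigen (X n) (A0 n) g,
    12 * (tau n * #|A0 n|%:R / g ^+ 2) <= b &
    12 * (tau n * #|A0 n|%:R / g ^+ 2) <= 4^-1] by near: n; exact: near_RE.
have Xcol := normalized_dotv n0 (Xnorm n n0).
have [U1 U1P] := span_isometry (X n) (beta n) 1%:M.
have [U2 U2P] := span_isometry (X n) (beta n) (1%:M - colproj (subcols (A0 n) (X n))).
have [bad [mbad Pbad good]] := good_noise_event n0 sigma_gt0 Xcol (indep n) (subg n)
  rho'_gt0 (@rho'E n) (fun B => (U1P B).1) (fun B => (U2P B).1) (D n) (L n).
apply: (inner_prob_ge mbad Pbad) => w /= /good[e1 e2 e3 e4 e5].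
apply: (@selects_support_nondegenerate _ _ _ _ _ n0 Xcol pen J a b g (tau n) (lam n)
  (C n) (K n) (lamhat n w) (bhat1 n w) (bhat n w) (noise (eps n) w) g0 RE b_gt0 reg
  a_gt1 (lam_gt0 n n0) (tau_gt0 n n0) _ rb r4 _ (path n w n0) (C_gt0 n n0) (qK n n0)
  (sel n w n0) _ U1 U2 (L n) c0 M cT kap) => //.
- by near: n; exact: near_tau.
- by near: n; exact: near_sig.
- move=> j; suff -> : n%:R * (tau n * lam n) ^+ 2 = D n by exact: e1.
  by rewrite /D; ring.
- by move=> B v s vB; have := (U1P B).2 v s vB; rewrite !mul1mx.
- by move=> B v s vB; have := (U2P B).2 v s vB.
- rewrite ln_gt0//; apply: (@lt_le_trans _ _ 2); first by rewrite ltr1n.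
  by near: n; exact: near_p.
- move=> A nA AK; apply: (underfit_gap_le (K := K n)) => //.
  by near: n; exact: near_gap.
- by near: n; exact: near_K1.
- by near: n; exact: near_K2.
- by rewrite -ltr_pdivrMr//; near: n; exact: near_C.
- rewrite ltr_pdivrMr//; apply: (@le_lt_trans _ _ (omega / 2 * n%:R)).
    rewrite -[X in _ <= _ * X](ger0_norm (ltW nR0)); apply: (le_trans (ler_norm _)).
    by near: n; exact: near_qC.
  by rewrite ltr_pM2r//; move: omega_gt0; rewrite -/omega; lra.
Unshelve. all: by end_near. Qed.
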